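(* Let $X=\Lambda U+\Psi^{1/2}V\sim \mathrm{SUN}_{d,m}(0,\Omega,\Delta,\tau,\Gamma)$, with $\Lambda,\Psi,U,V$ as defined in the context. Then \begin{align*} \mu_1(X)&=\Lambda \mu_1(U),\\ \mu_2(X)&=\Lambda \mu_2(U)\Lambda^{\top}+\Psi,\\ \mu_3(X)&=(\Lambda\otimes\Lambda)\mu_3(U)\Lambda^{\top}+(I_{d^2}+K_d)(\Lambda \mu_1(U)\otimes \Psi)+\mathrm{vec}(\Psi)\mu_1(U)^{\top}\Lambda^{\top},\\ \mu_4(X)&=(\Lambda\otimes\Lambda)\mu_4(U)(\Lambda\otimes\Lambda)^{\top}+\mathrm{vec}(\Psi)\mathrm{vec}(\Psi)^{\top}\\ &\quad+(I_{d^2}+K_d)\big\{(\Lambda \mu_2(U)\Lambda^{\top}\otimes \Psi)+(\Psi\otimes \Lambda \mu_2(U)\Lambda^{\top})+\Psi\otimes \Psi\big\}\\ &\quad+\mathrm{vec}(\Lambda \mu_2(U)\Lambda^{\top})\mathrm{vec}(\Psi)^{\top}+\mathrm{vec}(\Psi)\mathrm{vec}(\Lambda \mu_2(U)\Lambda^{\top})^{\top}. \end{align*} Moreover, the variance matrix of $X$ is $$\mathrm{var}\{X\}=\Omega-\Lambda(\Gamma-\Sigma_U)\Lambda^{\top}=:\Sigma,$$ where $\Sigma_U=\mathrm{var}\{U\}=\mu_2(U)-\mu_1(U)\mu_1(U)^{\top}$. The inequality $\Omega>\Sigma$ holds, in the sense that the difference $\Omega-\Sigma$ is positive definite.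
   Context: Let $d,m$ be positive integers. Let $\Omega^*=\begin{pmatrix}\bar\Omega&\Delta\\ \Delta^{\top}&\Gamma\end{pmatrix}$ be a full-rank $(d+m)\times(d+m)$ correlation matrix ($\bar\Omega$ is $d\times d$, $\Delta$ is $d\times m$, $\Gamma$ is $m\times m$), let $\tau\in\mathbb{R}^m$, $\xi\in\mathbb{R}^d$, let $\omega$ be a $d\times d$ diagonal matrix with positive diagonal elements, and $\Omega=\omega\bar\Omega\omega$. If $(X_0,X_1)\sim \mathrm{N}_{d+m}(0,\Omega^* )$, with $X_0$ of dimension $d$, $\mathrm{SUN}_{d,m}(\xi,\Omega,\Delta,\tau,\Gamma)$ denotes the distribution of $\xi+\omega Z$, where $Z$ has the distribution of $X_0$ conditional on $X_1+\tau>0$ (componentwise). Put $\Lambda=\omega\Delta\Gamma^{-1}$ and $\Psi=\Omega-\omega\Delta\Gamma^{-1}\Delta^{\top}\omega$ (which is positive definite), and let $\Psi^{1/2}$ be its symmetric positive definite square root. Let $V\sim \mathrm{N}_d(0,I_d)$ and $W\sim \mathrm{N}_m(0,\Gamma)$ be independent, and let $U$ be a random vector independent of $V$ having the distribution of $W$ conditional on $W+\tau>0$ (componentwise). Then $\Lambda U+\Psi^{1/2}V\sim\mathrm{SUN}_{d,m}(0,\Omega,\Delta,\tau,\Gamma)$ (additive representation). For a random (column) vector $X$: $\mu_1(X)=\mathbb{E}\{X\}$, $\mu_2(X)=\mathbb{E}\{XX^{\top}\}$, $\mu_3(X)=\mathbb{E}\{X\otimes XX^{\top}\}$, $\mu_4(X)=\mathbb{E}\{XX^{\top}\otimes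 XX^{\top}\}$, where $\otimes$ is the Kronecker product. The operator $\mathrm{vec}$ stacks the columns of a matrix into a single vector. The commutation matrix is $K_{pq}=\sum_{i=1}^p\sum_{j=1}^q E_{ij}\otimes E_{ij}^{\top}$, where $E_{ij}$ is the $p\times q$ matrix with 1 in position $(i,j)$ and 0 elsewhere, and $K_r=K_{rr}$.
   Formalization: The claim that Ω−Σ is positive definite fails if rank Δ < d (e.g. Δ = 0 gives Ω−Σ = 0); it is proved under the necessary and sufficient condition rank Δ = d, and Ω−Σ is shown positive semidefinite in general. *)

(* Defs.v *)
From HB Require Import structures.
From mathcomp Require Import all_boot all_order all_algebra.
From mathcomp Require Import all_classical all_reals all_analysis.
From mathcomp Require Import mxtens.

Set Implicit Arguments.
Unset Strict Implicit.
Unset Printing Implicit Defensive.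

Import Order.TTheory GRing.Theory Num.Theory.
Import numFieldNormedType.Exports.

Local Open Scope classical_set_scope.
Local Open Scope ring_scope.

Definition measure_matrix_display : measure_display -> measure_display.
Proof. exact. Qed.

(* The product sigma-algebra, generated by the coordinate maps; over the reals
   it is the Borel sigma-algebra of R^(m x n). *)
Section measurable_matrix.
Context {disp : measure_display} {T : sigmaRingType disp}.
Variables m n : nat.

Definition matrix_cylinders : set (set 'M[T]_(m, n)) :=
  \bigcup_(ij in [set: 'I_m * 'I_n])
    preimage_set_system setT (fun M : 'M[T]_(m, n) => M ij.1 ij.2) measurable.

Let matrix_set0 : <<s matrix_cylinders >> set0.
Proof. exact: sigma_algebra0. Qed.

Let matrix_setC A : <<s matrix_cylinders >> A -> <<s matrix_cylinders >> (~` A).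
Proof. exact: sigma_algebraC. Qed.

Let matrix_bigcup (F : (set 'M[T]_(m, n))^nat) :
  (forall i, <<s matrix_cylinders >> (F i)) ->
  <<s matrix_cylinders >> (\bigcup_i F i).
Proof. exact: sigma_algebra_bigcup. Qed.

HB.instance Definition _ := @isMeasurable.Build (measure_matrix_display disp)
  'M[T]_(m, n) <<s matrix_cylinders >> matrix_set0 matrix_setC matrix_bigcup.

End measurable_matrix.

Section measurable_matrix_lemmas.
Context {disp disp' : measure_display}.
Context {S : measurableType disp'} {T : measurableType disp}.
Variables m n : nat.

Lemma measurable_coord (i : 'I_m) (j : 'I_n) :
  measurable_fun [set: 'M[T]_(m, n)] (fun M : 'M[T]_(m, n) => M i j).
Proof.
move=> _ Y mY; rewrite setTI; apply: sub_sigma_algebra.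
by exists (i, j) => //; exists Y => //; rewrite setTI.
Qed.

Lemma measurable_matrix (f : S -> 'M[T]_(m, n)) :
  (forall i j, measurable_fun setT (fun s => f s i j)) -> measurable_fun setT f.
Proof.
move=> mf; apply: (@measurability _ _ _ _ _ _ (@matrix_cylinders _ T m n)) => //.
move=> _ [A [[i j] _ [B mB <-]] <-].
by rewrite !setTI -[X in measurable X]setTI; exact: mf.
Qed.

End measurable_matrix_lemmas.

Section lebesgue_cV.
Context {R : realType}.

Definition cons_cV n (xv : R * 'cV[R]_n) : 'cV[R]_n.+1 :=
  col_mx (const_mx xv.1 : 'cV_1) xv.2.

Definition uncons_cV n (v : 'cV[R]_n.+1) : R * 'cV[R]_n :=
  (v ord0 0, \col_i v (lift ord0 i) 0).

Lemma cons_cV0 n (xv : R * 'cV[R]_n) : cons_cV xv ord0 0 = xv.1.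
Proof.
have -> : ord0 = lshift n (ord0 : 'I_1) by exact: val_inj.
by apply: etrans (col_mxEu _ _ _ _) _; rewrite mxE.
Qed.

Lemma cons_cVS n (xv : R * 'cV[R]_n) i : cons_cV xv (lift ord0 i) 0 = xv.2 i 0.
Proof.
have -> : lift ord0 i = rshift 1 i by exact: val_inj.
exact: col_mxEd.
Qed.

Lemma cons_cVK n : cancel (@cons_cV n) (@uncons_cV n).
Proof.
move=> [x v]; rewrite /uncons_cV cons_cV0; congr pair.
by apply/matrixP => i j; rewrite mxE cons_cVS (ord1 j).
Qed.

Lemma measurable_cons_cV n : measurable_fun setT (@cons_cV n).
Proof.
apply: measurable_matrix => i j; rewrite (ord1 j).
have [k ->|->] := unliftP ord0 i.
  apply: (eq_measurable_fun ((fun v : 'cV[R]_n => v k 0) \o snd)).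
    by move=> xv _; rewrite cons_cVS.
  by apply: measurableT_comp => //; exact: measurable_coord.
by apply: (eq_measurable_fun fst) => // xv _; rewrite cons_cV0.
Qed.

Lemma measurable_uncons_cV n : measurable_fun setT (@uncons_cV n).
Proof.
apply: measurable_fun_pair; first exact: measurable_coord.
apply: measurable_matrix => i j.
apply: (eq_measurable_fun (fun v : 'cV[R]_n.+1 => v (lift ord0 i) 0)).
  by move=> v _; rewrite mxE.
exact: measurable_coord.
Qed.

Section cons_measure.
Variables (n : nat) (mu : {sigma_finite_measure set 'cV[R]_n -> \bar R}).

Definition cons_measure : set 'cV[R]_n.+1 -> \bar R :=
  pushforward (@lebesgue_measure R \x mu)%E (@cons_cV n).

Let cons_measure0 : cons_measure set0 = 0%E.
Proof. by rewrite /cons_measure /pushforward preimage_set0 measure0. Qed.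

Let cons_measure_ge0 A : (0 <= cons_measure A)%E.
Proof. by rewrite /cons_measure /pushforward; exact: measure_ge0. Qed.

Let cons_measure_sigma_additive : semi_sigma_additive cons_measure.
Proof.
move=> F mF tF mUF; rewrite /cons_measure /pushforward preimage_bigcup.
have mcons A : measurable A -> measurable (@cons_cV n @^-1` A).
  by move=> mA; rewrite -[X in measurable X]setTI; exact: measurable_cons_cV.
apply: measure_semi_sigma_additive.
- by move=> k; exact: mcons.
- apply/trivIsetP => /= i j _ _ ij; rewrite -preimage_setI.
  by move/trivIsetP : tF => /(_ _ _ _ _ ij) ->//; rewrite preimage_set0.
- by rewrite -preimage_bigcup; exact: mcons.
Qed.

HB.instance Definition _ := isMeasure.Build _ _ _ cons_measure
  cons_measure0 cons_measure_ge0 cons_measure_sigma_additive.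

Let cons_measure_sigma_finite : sigma_finite setT cons_measure.
Proof.
have /sigma_finiteP[F [TF ndF Foo]] := sigma_finiteT (@lebesgue_measure R).
have /sigma_finiteP[G [TG ndG Goo]] := sigma_finiteT mu.
exists (fun k => @uncons_cV n @^-1` (F k `*` G k)).
  rewrite -preimage_bigcup; apply/seteqP; split=> // v _ /=.
  have [[i _ Fi] [j _ Gj]] : (\bigcup_k F k) (uncons_cV v).1 /\
      (\bigcup_k G k) (uncons_cV v).2 by rewrite -TF -TG.
  exists (maxn i j) => //; split.
    by move: Fi; exact/subsetPset/ndF/leq_maxl.
  by move: Gj; exact/subsetPset/ndG/leq_maxr.
move=> k; have [mF Fk] := Foo k; have [mG Gk] := Goo k; split.
  rewrite -[X in measurable X]setTI; apply: measurable_uncons_cV => //.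
  exact: measurableX.
rewrite /cons_measure /pushforward -comp_preimage.
rewrite (_ : _ \o _ = id); last by apply/funext => x; exact: cons_cVK.
by rewrite preimage_id product_measure1E// lte_mul_pinfty// ge0_fin_numE//.
Qed.

HB.instance Definition _ := Measure_isSigmaFinite.Build _ _ _ cons_measure
  cons_measure_sigma_finite.

End cons_measure.

Let dirac0_sigma_finite : sigma_finite setT (@dirac _ 'cV[R]_0 0 R).
Proof.
exists (fun=> setT); first by rewrite bigcup_const.
by move=> k; split => //; rewrite diracT ltry.
Qed.

Definition dirac_cV0 : set 'cV[R]_0 -> \bar R := @dirac _ 'cV[R]_0 0 R.

HB.instance Definition _ := Measure.on dirac_cV0.
HB.instance Definition _ := Measure_isSigmaFinite.Build _ _ _ dirac_cV0
  dirac0_sigma_finite.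

(* Lebesgue measure on R^n, as an iterated product measure. *)
Fixpoint lebesgue_cV n : {sigma_finite_measure set 'cV[R]_n -> \bar R} :=
  match n with
  | 0 => dirac_cV0
  | n'.+1 => cons_measure (lebesgue_cV n')
  end.

End lebesgue_cV.

Section matrices.
Context {R : realType}.

Definition posdefmx n (M : 'M[R]_n) :=
  M^T = M /\ forall x : 'cV[R]_n, x != 0 -> 0 < (x^T *m M *m x) 0 0.

Definition possemidefmx n (M : 'M[R]_n) :=
  M^T = M /\ forall x : 'cV[R]_n, 0 <= (x^T *m M *m x) 0 0.

Definition correlation_mx n (M : 'M[R]_n) :=
  possemidefmx M /\ forall i, M i i = 1.

Definition posdef_sqrt n (S M : 'M[R]_n) := posdefmx S /\ S *m S = M.

(* Entry (j, i), in the row-major indexing used by the Kronecker product, of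
   vec M is M i j: this is the stacking of the columns of M. *)
Definition vec m n (M : 'M[R]_(m, n)) : 'cV[R]_(n * m) :=
  \col_k M (mxtens_unindex k).2 (mxtens_unindex k).1.

(* x (x) M for a column vector x; the cast only identifies 1 * q with q. *)
Definition tens_cV n p q (x : 'cV[R]_n) (M : 'M[R]_(p, q)) : 'M[R]_(n * p, q) :=
  castmx (erefl (n * p)%N, mul1n q) (x *t M).

Definition commutation_mx p q : 'M[R]_(p * q, q * p) :=
  \sum_(i < p) \sum_(j < q) (delta_mx i j *t (delta_mx i j)^T).

End matrices.

Section moments.
Context {disp : measure_display} {T : measurableType disp} {R : realType}.
Variable P : probability T R.

Definition integrable_mx p q (M : T -> 'M[R]_(p, q)) :=
  forall i j, P.-integrable setT (fun t => (M t i j)%:E).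

(* Meaningful under integrable_mx: fine sends infinite values to 0. *)
Definition expectation_mx p q (M : T -> 'M[R]_(p, q)) : 'M[R]_(p, q) :=
  \matrix_(i, j) fine 'E_P[fun t => M t i j].

Definition outer n (X : T -> 'cV[R]_n) (t : T) : 'M[R]_n := X t *m (X t)^T.

Definition mu1 n (X : T -> 'cV[R]_n) : 'cV[R]_n := expectation_mx X.

Definition mu2 n (X : T -> 'cV[R]_n) : 'M[R]_n := expectation_mx (outer X).

Definition mu3 n (X : T -> 'cV[R]_n) : 'M[R]_(n * n, n) :=
  expectation_mx (fun t => tens_cV (X t) (outer X t)).

Definition mu4 n (X : T -> 'cV[R]_n) : 'M[R]_(n * n, n * n) :=
  expectation_mx (fun t => outer X t *t outer X t).

Definition moments4_exist n (X : T -> 'cV[R]_n) :=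
  [/\ integrable_mx X, integrable_mx (outer X),
      integrable_mx (fun t => tens_cV (X t) (outer X t)) &
      integrable_mx (fun t => outer X t *t outer X t)].

Definition variance_mx n (X : T -> 'cV[R]_n) : 'M[R]_n :=
  \matrix_(i, j) fine (covariance P (fun t => X t i 0) (fun t => X t j 0)).

Definition independent_rv d1 d2 (T1 : measurableType d1) (T2 : measurableType d2)
    (X : T -> T1) (Y : T -> T2) :=
  forall A B, measurable A -> measurable B ->
    P (X @^-1` A `&` Y @^-1` B) = (P (X @^-1` A) * P (Y @^-1` B))%E.

End moments.

Section distributions.
Context {R : realType}.

(* nu (A | B); meaningful when 0 < nu B < +oo. *)
Definition cond_prob d (T : measurableType d) (nu : set T -> \bar R)
    (A B : set T) : \bar R :=
  (fine (nu (A `&` B)) / fine (nu B))%:E.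

(* The density with respect to Lebesgue measure: S must be positive definite. *)
Definition mvnormal_pdf n (mu : 'cV[R]_n) (S : 'M[R]_n) (x : 'cV[R]_n) : R :=
  (Num.sqrt ((2 * pi) ^+ n * \det S))^-1 *
  expR (- ((x - mu)^T *m invmx S *m (x - mu)) 0 0 / 2).

Definition mvnormal_prob n (mu : 'cV[R]_n) (S : 'M[R]_n)
    (A : set 'cV[R]_n) : \bar R :=
  (\int[lebesgue_cV n]_(x in A) (mvnormal_pdf mu S x)%:E)%E.

Definition has_law d (T : measurableType d) (P : probability T R)
    d' (T' : measurableType d') (X : {RV P >-> T'}) (nu : set T' -> \bar R) :=
  forall A, measurable A -> distribution P X A = nu A.

Definition pos_cV n : set 'cV[R]_n := [set x | forall i, 0 < x i 0].

(* SUN_{d,m}(xi, Omega, Delta, tau, Gamma) with Omega = omega Omegabar omega: the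
   law of xi + omega X0 given X1 + tau > 0, where z = (X0, X1) is centred normal. *)
Definition SUN_prob d m (xi : 'cV[R]_d) (omega Omegabar : 'M[R]_d)
    (Delta : 'M[R]_(d, m)) (tau : 'cV[R]_m) (Gamma : 'M[R]_m)
    (A : set 'cV[R]_d) : \bar R :=
  cond_prob (mvnormal_prob 0 (block_mx Omegabar Delta Delta^T Gamma))
    [set z : 'cV[R]_(d + m) | A (xi + omega *m usubmx z)]
    [set z : 'cV[R]_(d + m) | pos_cV (dsubmx z + tau)].

End distributions.

(* Main.v *)
Require Import Defs.
From HB Require Import structures.
From mathcomp Require Import all_boot all_order all_algebra.
From mathcomp Require Import all_classical all_reals all_analysis.
From mathcomp Require Import mxtens measurable_realfun lebesgue_integral.
From mathcomp Require Import ring lra.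
Import Order.TTheory GRing.Theory Num.Theory.
Import numFieldNormedType.Exports.
Local Open Scope classical_set_scope.
Local Open Scope ring_scope.

(* For centred Gaussian Y, translation invariance of Lebesgue measure gives the
   Cameron-Martin formula E f(Y + s Gamma a) = E f(Y) exp(s a.Y - s^2 a'Gamma a / 2);
   its first order term at s = 0 is Stein's identity
   E (a.Y) f(Y) = E (D_{Gamma a} f)(Y), from which the moments of Y of order at
   most four follow. Independence then reduces the moments of Lambda U + Y to
   those of Lambda U and of Y, by expanding products entrywise.

   For the variance, var X = Omega - Lambda (Gamma - var U) Lambda', and
   var(a.U) < a'Gamma a is proved by symmetrisation: for U' an independent copy of
   U, write U = z + u/2 and U' = z - u/2. Given z, the vector u is N(0, 2 Gamma)
   restricted to a symmetric convex set; by the Prekopa-Leindler inequality its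
   moment generating function is at most that of N(0, 2 Gamma), hence
   E((a.u)^2 | z) <= 2 a'Gamma a, while for z close to the vertex of the orthant
   u is so small that the left-hand side is at most a'Gamma a. *)

(** * Integration on column vectors *)

(** Symmetrisation removes the unknown mean of U: var(a.U) is half of E (a.(U - U'))^2, and given
    the midpoint the difference is centred. The symmetry of its range also gives the tilts by t and
    - t the same mass, so that a single use of Prekopa-Leindler bounds the moment generating
    function. This yields only a weak inequality for each z, whence the separate gain on a corner of
    positive mass.

    Stein's identity is reached without integration by parts or derivatives under the integral: the
    test functions are products of at most three linear forms, so f(Y + s Gamma a) is a cubic in s,
    and first order coefficients are compared.

    The Gaussian integral is never evaluated: the existence of V and W, whose laws have total mass
    1, makes it finite.

    The matrix Omega - Sigma = Lambda (Gamma - var U) Lambda' is always semidefinite, but it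
    vanishes on the kernel of Lambda'; for Delta = 0 it is 0. Hence positive definiteness is tied to
    Delta having rank d. *)

Section integration_cV.
Set Implicit Arguments.
Unset Strict Implicit.
Context {R : realType}.
Local Open Scope ereal_scope.

Lemma integral_lebesgue_cV0 (f : 'cV[R]_0 -> \bar R) :
  measurable_fun setT f -> \int[lebesgue_cV 0]_x f x = f 0%R.
Proof. by move=> mf; rewrite integral_dirac// diracT mul1e. Qed.

Lemma integral_lebesgue_cVS n (f : 'cV[R]_n.+1 -> \bar R) :
  measurable_fun setT f -> (forall x, 0 <= f x) ->
  \int[lebesgue_cV n.+1]_x f x =
  \int[lebesgue_measure]_s \int[lebesgue_cV n]_v f (cons_cV (s, v)).
Proof.
move=> mf f0.
have mfc : measurable_fun setT (f \o @cons_cV R n).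
  by apply: measurableT_comp => //; exact: measurable_cons_cV.
transitivity (\int[lebesgue_measure \x lebesgue_cV n]_z (f \o @cons_cV R n) z).
  by apply: ge0_integral_pushforward => //; exact: measurable_cons_cV.
exact: (@fubini_tonelli1 _ _ _ _ _ lebesgue_measure (lebesgue_cV n) _ mfc (fun=> f0 _)).
Qed.

Lemma measurable_affine (c b : R) :
  measurable_fun setT (fun x : measurableTypeR R => c * x + b : measurableTypeR R)%R.
Proof. by apply: measurable_funD => //; exact: measurable_funM. Qed.

(** By uniqueness of Lebesgue measure only the intervals ]x, y] have to be tested; for c < 0 the
    preimage is reversed and closed on the left, hence the two cases. *)
Lemma lebesgue_measure_affine (c b : R) (A : set R) : (c != 0)%R -> measurable A ->
  lebesgue_measure A =
  `|c|%:E * pushforward (@lebesgue_measure R)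
    (fun x : measurableTypeR R => c * x + b : measurableTypeR R)%R A.
Proof.
move=> c0 mA.
have c0' : (0 <= `|c|)%R by [].
have mphi := measurable_affine c b.
pose phi := (fun x : measurableTypeR R => c * x + b : measurableTypeR R)%R.
pose m0 : {measure set (measurableTypeR R) -> \bar R} :=
  pushforward (@lebesgue_measure R) phi.
pose m' : {measure set (measurableTypeR R) -> \bar R} :=
  mscale (NngNum c0') (m0 mphi).
have -> : `|c|%:E * pushforward (@lebesgue_measure R)
    (fun x : measurableTypeR R => c * x + b : measurableTypeR R)%R A = m' A by [].
apply: (@lebesgue_measure_unique _ m') => // _ [[x y]] /= _ <-.
rewrite /mscale/= /pushforward.
have [cgt|clt|ceq] := ltgtP c 0%R; last by rewrite ceq eqxx in c0.
- rewrite (_ : _ @^-1` _ = [set` `[((y - b) / c)%R, ((x - b) / c)%R[]); last first.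
    apply/seteqP; split => z /=; rewrite !in_itv/= => /andP[].
      by rewrite ler_ndivrMr// ltr_ndivlMr// (mulrC z) lerBrDr ltrBlDr => -> ->.
    by rewrite ler_ndivrMr// ltr_ndivlMr// (mulrC z) lerBrDr ltrBlDr => -> ->.
  rewrite !lebesgue_measure_itv/= !lte_fin ltr_nM2r ?invr_lt0// ltrD2r.
  case: ifPn => _; last by rewrite mule0.
  rewrite -!EFinB -EFinM ltr0_norm//; congr (_%:E); field; exact: c0.
- rewrite (_ : _ @^-1` _ = [set` `]((x - b) / c)%R, ((y - b) / c)%R]]); last first.
    apply/seteqP; split => z /=; rewrite !in_itv/= => /andP[].
      by rewrite ler_pdivlMr// ltr_pdivrMr// (mulrC z) lerBrDr ltrBlDr => -> ->.
    by rewrite ler_pdivlMr// ltr_pdivrMr// (mulrC z) lerBrDr ltrBlDr => -> ->.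
  rewrite !lebesgue_measure_itv/= !lte_fin ltr_pM2r ?invr_gt0// ltrD2r.
  case: ifPn => _; last by rewrite mule0.
  rewrite -!EFinB -EFinM gtr0_norm//; congr (_%:E); field; exact: c0.
Qed.

Lemma ge0_integral_affine (c b : R) (f : R -> \bar R) : (c != 0)%R ->
  measurable_fun setT f -> (forall x, 0 <= f x) ->
  \int[lebesgue_measure]_x f x = `|c|%:E * \int[lebesgue_measure]_x f (c * x + b)%R.
Proof.
move=> c0 mf f0.
have c0' : (0 <= `|c|)%R by [].
have mphi := measurable_affine c b.
pose phi := (fun x : measurableTypeR R => c * x + b : measurableTypeR R)%R.
pose m0 : {measure set (measurableTypeR R) -> \bar R} :=
  pushforward (@lebesgue_measure R) phi.
pose m' : {measure set (measurableTypeR R) -> \bar R} := mscale (NngNum c0') (m0 mphi).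
rewrite (eq_measure_integral m'); last first.
  move=> A mA _; exact: lebesgue_measure_affine.
rewrite ge0_integral_mscale//; congr (_ * _).
exact: (@ge0_integral_pushforward _ _ _ _ R phi mphi lebesgue_measure setT f
  measurableT mf (fun _ _ => f0 _)).
Qed.

Lemma cons_cVD n (x y : R * 'cV[R]_n) :
  (cons_cV (x.1 + y.1, x.2 + y.2) = cons_cV x + cons_cV y)%R.
Proof.
apply/matrixP => i j; rewrite (ord1 j) [RHS]mxE.
by have [k ->|->] := unliftP ord0 i; rewrite ?cons_cVS ?cons_cV0//= mxE.
Qed.

Lemma cons_cVZ n (c : R) (x : R * 'cV[R]_n) :
  (cons_cV (c * x.1, c *: x.2) = c *: cons_cV x)%R.
Proof.
apply/matrixP => i j; rewrite (ord1 j) [RHS]mxE.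
by have [k ->|->] := unliftP ord0 i; rewrite ?cons_cVS ?cons_cV0//= mxE.
Qed.

Lemma uncons_cVK n : cancel (@uncons_cV R n) (@cons_cV R n).
Proof.
move=> x; apply/matrixP => i j; rewrite (ord1 j).
by have [k ->|->] := unliftP ord0 i; rewrite ?cons_cVS ?cons_cV0//= mxE.
Qed.

Lemma measurable_addmx d (T : measurableType d) m n (f g : T -> 'M[R]_(m, n)) :
  measurable_fun setT f -> measurable_fun setT g ->
  measurable_fun setT (fun t => f t + g t)%R.
Proof.
move=> mf mg; apply: measurable_matrix => i j.
apply: (eq_measurable_fun (fun t => f t i j + g t i j)%R).
  by move=> t _; rewrite mxE.
by apply: measurable_funD; apply: (measurableT_comp (measurable_coord i j)).
Qed.

Lemma measurable_mulmx d (T : measurableType d) m n p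
    (f : T -> 'M[R]_(m, n)) (g : T -> 'M[R]_(n, p)) :
  measurable_fun setT f -> measurable_fun setT g ->
  measurable_fun setT (fun t => f t *m g t)%R.
Proof.
move=> mf mg; apply: measurable_matrix => i j.
apply: (eq_measurable_fun (fun t => \sum_k f t i k * g t k j)%R).
  by move=> t _; rewrite mxE.
apply: measurable_sum => k.
by apply: measurable_funM; apply: (measurableT_comp (measurable_coord _ _)).
Qed.

Lemma measurable_trmx m n : measurable_fun setT (fun M : 'M[R]_(m, n) => M^T)%R.
Proof.
apply: measurable_matrix => i j; apply: (eq_measurable_fun (fun M : 'M[R]_(m, n) => M j i)).
  by move=> M _; rewrite mxE.
exact: measurable_coord.
Qed.

Lemma measurable_scalemx d (T : measurableType d) m n (c : R) (f : T -> 'M[R]_(m, n)) :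
  measurable_fun setT f -> measurable_fun setT (fun t => c *: f t)%R.
Proof.
move=> mf; apply: measurable_matrix => i j.
apply: (eq_measurable_fun (fun t => c * f t i j)%R).
  by move=> t _; rewrite mxE.
by apply: measurable_funM => //; apply: (measurableT_comp (measurable_coord i j)).
Qed.

(** Used with c = 1, to move the centre of a Gaussian, and with c = -1, to exploit the symmetry of a
    set. Each coordinate contributes one factor [|c|]. *)
Lemma ge0_integral_affine_cV n (c : R) (b : 'cV[R]_n) (f : 'cV[R]_n -> \bar R) :
  (c != 0)%R -> measurable_fun setT f -> (forall x, 0 <= f x) ->
  \int[lebesgue_cV n]_x f x =
  (`|c| ^+ n)%:E * \int[lebesgue_cV n]_x f (c *: x + b)%R.
Proof.
move=> c0; elim: n b f => [|n IH] b f mf f0.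
  rewrite !integral_lebesgue_cV0// ?expr0 ?mul1e ?[b]flatmx0 ?scaler0 ?addr0//.
  apply: measurableT_comp => //; apply: measurable_addmx => //.
  exact: measurable_scalemx.
have maff : measurable_fun setT (fun x : 'cV[R]_n.+1 => f (c *: x + b)%R).
  apply: measurableT_comp => //; apply: measurable_addmx => //.
  exact: measurable_scalemx.
have mfc : measurable_fun setT (f \o @cons_cV R n).
  by apply: measurableT_comp => //; exact: measurable_cons_cV.
rewrite integral_lebesgue_cVS// integral_lebesgue_cVS//.
pose F s := \int[lebesgue_cV n]_v f (cons_cV (s, v)).
have mF : measurable_fun setT F.
  exact: (measurable_fun_fubini_tonelli_F (m2 := lebesgue_cV n) _ mfc (fun=> f0 _)).
have F0 s : 0 <= F s by apply: integral_ge0 => v _.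
rewrite (ge0_integral_affine (b ord0 0%R) c0 mF F0).
rewrite exprS EFinM -muleA; congr (_ * _).
rewrite -ge0_integralZl//; last 2 first.
- have mG : measurable_fun setT (fun x : R * 'cV[R]_n => f (c *: cons_cV x + b)%R).
    by apply: (measurableT_comp maff); exact: measurable_cons_cV.
  exact: (measurable_fun_fubini_tonelli_F (m2 := lebesgue_cV n) _ mG (fun=> f0 _)).
- by move=> s _; apply: integral_ge0 => v _.
apply: eq_integral => s _; rewrite /F (IH (\col_i b (lift ord0 i) 0)%R)//.
  congr (_ * _); apply: eq_integral => v _; congr (f _).
  rewrite -(cons_cVZ c (s, v)); apply: etrans (cons_cVD (_, _) (uncons_cV b)) _.
  by rewrite uncons_cVK.
apply: (measurableT_comp mf); apply: (measurableT_comp (@measurable_cons_cV R n)).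
exact: measurable_fun_pair.
Qed.

End integration_cV.

(** * The Prekopa-Leindler inequality *)

Section midpoint_inequality.
Set Implicit Arguments.
Unset Strict Implicit.
Context {R : realType}.
Local Open Scope ereal_scope.
Notation leb := (@lebesgue_measure R).

Lemma ge0_integral_translate_cV n (b : 'cV[R]_n) (f : 'cV[R]_n -> \bar R) :
  measurable_fun setT f -> (forall x, 0 <= f x) ->
  \int[lebesgue_cV n]_x f x = \int[lebesgue_cV n]_x f (x + b)%R.
Proof.
move=> mf f0; rewrite (ge0_integral_affine_cV (c := 1) b)// ?oner_neq0//.
rewrite normr1 expr1n mul1e; apply: eq_integral => x _.
by rewrite scale1r.
Qed.

(** The change of variables is composed of two shears: x = y + u with y fixed, then y = z - u / 2
    with u fixed. Each is a translation in the inner integral, and Tonelli exchanges the integrals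
    in between, so no Jacobian appears. *)
Lemma ge0_integral_midpoint n (F : 'cV[R]_n * 'cV[R]_n -> \bar R) :
  measurable_fun setT F -> (forall z, 0 <= F z) ->
  \int[lebesgue_cV n]_x \int[lebesgue_cV n]_y F (x, y) =
  \int[lebesgue_cV n]_z \int[lebesgue_cV n]_u F (z + 2^-1 *: u, z - 2^-1 *: u)%R.
Proof.
move=> mF F0.
have m1 : measurable_fun setT (fun z : 'cV[R]_n * 'cV[R]_n => F (z.1 + z.2, z.2)%R).
  apply: (measurableT_comp mF); apply: measurable_fun_pair => //.
  exact: measurable_addmx.
have mhalf c : measurable_fun setT (fun z : 'cV[R]_n * 'cV[R]_n => z.1 + c *: z.2)%R.
  by apply: measurable_addmx => //; exact: measurable_scalemx.
rewrite (@fubini_tonelli _ _ _ _ _ (lebesgue_cV n) (lebesgue_cV n) F mF F0).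
transitivity (\int[lebesgue_cV n]_y \int[lebesgue_cV n]_u F (y + u, y)%R).
  apply: eq_integral => y _.
  rewrite (ge0_integral_translate_cV (f := fun x => F (x, y)) y)//.
    by apply: eq_integral => u _; rewrite addrC.
  by apply: (measurableT_comp mF); exact: measurable_fun_pair.
rewrite (@fubini_tonelli _ _ _ _ _ (lebesgue_cV n) (lebesgue_cV n)
  (fun z => F (z.1 + z.2, z.1)%R)); last 2 first.
- apply: (measurableT_comp mF); apply: measurable_fun_pair => //.
  exact: measurable_addmx.
- by move=> z; exact: F0.
rewrite [RHS](@fubini_tonelli _ _ _ _ _ (lebesgue_cV n) (lebesgue_cV n)
  (fun z => F (z.1 + 2^-1 *: z.2, z.1 - 2^-1 *: z.2)%R)); last 2 first.
- apply: (measurableT_comp mF); apply: measurable_fun_pair; first exact: mhalf.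
  by under eq_fun do rewrite -scaleNr; exact: mhalf.
- by move=> z; exact: F0.
apply: eq_integral => u _ /=.
rewrite (ge0_integral_translate_cV (f := fun y => F (y + u, y)%R)
  (- (2^-1 *: u))%R)//; last first.
  apply: (measurableT_comp mF); apply: measurable_fun_pair => //.
  exact: measurable_addmx.
apply: eq_integral => z _; congr (F (_, _)).
by rewrite -addrA; congr (_ + _)%R; rewrite -{2}(scale1r u) -scaleNr -scalerDl;
  congr (_ *: _); field.
Qed.

(* With p = max K and q = min L, the sets (K + q) / 2 and (p + L) / 2 both lie in
   E and meet at most at (p + q) / 2. *)
Lemma compact_lebesgue_midpoint (K L E : set R) (a b : R) :
  compact K -> compact L -> measurable E -> K a -> L b ->
  (forall x y, K x -> L y -> E ((x + y) / 2)%R) ->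
  leb K + leb L <= 2%:E * leb E.
Proof.
move=> cK cL mE Ka Lb KLE.
have [p /set_mem Kp Kmax] : exists2 c, c \in K & forall t, t \in K -> (t <= c)%R.
  apply: (@compact_EVT_max _ _ id) => //; first by exists a.
  by apply: continuous_subspaceT => x; exact: cvg_id.
have [q /set_mem Lq Lmin] : exists2 c, c \in L & forall t, t \in L -> (c <= t)%R.
  apply: (@compact_EVT_min _ _ id) => //; first by exists b.
  by apply: continuous_subspaceT => x; exact: cvg_id.
pose K' := [set x | K (2 * x + - q)%R].
pose L' := [set x | L (2 * x + - p)%R].
have mK := compact_measurable cK; have mL := compact_measurable cL.
have mK' : measurable K'.
  rewrite -[K']setTI; exact: (@measurable_affine R 2 (- q)%R).
have mL' : measurable L'.
  rewrite -[L']setTI; exact: (@measurable_affine R 2 (- p)%R).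
have n2 : (2 != 0 :> R)%R by [].
rewrite (lebesgue_measure_affine (- q)%R n2 mK).
rewrite (lebesgue_measure_affine (- p)%R n2 mL).
rewrite -/K' -/L' /pushforward ger0_norm// -ge0_muleDr//.
apply: lee_pmul => //; first by rewrite adde_ge0.
pose r := ((p + q) / 2)%R.
have K'r x : K' x -> (x <= r)%R.
  by move=> /mem_set /Kmax; rewrite /r; lra.
have L'r x : L' x -> (r <= x)%R.
  by move=> /mem_set /Lmin; rewrite /r; lra.
have -> : leb K' = leb (K' `\ r).
  apply/eqP; rewrite eq_le; apply/andP; split; last first.
    by apply: le_measure; rewrite ?inE//; exact: measurableD.
  rewrite -[leb (K' `\ r)]adde0 -(lebesgue_measure_set1 r).
  apply: le_trans (measureU2 _ _ _) => //; last exact: measurableD.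
  apply: le_measure; rewrite ?inE//; first by apply: measurableU => //; exact: measurableD.
  by move=> x K'x; have [->|xr] := eqVneq x r; [right|left; split => //; exact/eqP].
rewrite -measureU//=; last 2 first.
- exact: measurableD.
- apply/seteqP; split => // x [[/K'r xr xner] /L'r rx].
  by apply: xner; apply/eqP; rewrite eq_le xr rx.
apply: le_measure; rewrite ?inE//.
  by apply: measurableU => //; exact: measurableD.
move=> x [[K'x _]|L'x].
- by have := KLE _ _ K'x Lq; rewrite (_ : _ / _ = x)%R//; field.
- by have := KLE _ _ Kp L'x; rewrite (_ : _ / _ = x)%R//; field.
Qed.

(** One-dimensional Brunn-Minkowski inequality, from the compact case by inner regularity, one
    supremum after the other. When E has infinite measure there is nothing to prove; otherwise all
    the measures are finite and can be subtracted. *)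
Lemma lebesgue_midpoint (A B E : set R) (a b : R) :
  measurable A -> measurable B -> measurable E -> A a -> B b ->
  (forall x y, A x -> B y -> E ((x + y) / 2)%R) ->
  leb A + leb B <= 2%:E * leb E.
Proof.
move=> mA mB mE Aa Bb ABE.
have [Efin|] := ltP (2%:E * leb E) +oo; last by rewrite leye_eq => /eqP ->; rewrite leey.
have KL K L : compact K -> K `<=` A -> compact L -> L `<=` B ->
    leb K + leb L <= 2%:E * leb E.
  move=> cK KA cL LB.
  have mK := compact_measurable cK; have mL := compact_measurable cL.
  (* An inner approximation may be empty, leaving no midpoints to compare; adding a and b prevents
     this. *)
  have cKa : compact (K `|` [set a]) by apply: compactU => //; exact: compact_set1.
  have cLb : compact (L `|` [set b]) by apply: compactU => //; exact: compact_set1.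
  apply: le_trans (compact_lebesgue_midpoint cKa cLb mE _ _ _); last 3 first.
  - by right.
  - by right.
  - by move=> x y [/KA Ax|->] [/LB By|->]; exact: ABE.
  by apply: leeD; apply: le_measure; rewrite ?inE//; try exact: measurableU;
    move=> x; left.
have fin1 K L : compact K -> K `<=` A -> compact L -> L `<=` B ->
    (leb K \is a fin_num) && (leb L \is a fin_num).
  move=> cK KA cL LB; have := le_lt_trans (KL _ _ cK KA cL LB) Efin.
  by rewrite !ge0_fin_numE// => h; apply/andP; split; apply: le_lt_trans h;
    [exact: leeDl|exact: leeDr].
rewrite (lebesgue_regularity_inner_sup mA) (lebesgue_regularity_inner_sup mB).
have c0 := @compact0 R; have s0 (C : set R) : set0 `<=` C := @sub0set _ C.
have AL L : compact L -> L `<=` B ->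
    leb A + leb L <= 2%:E * leb E.
  move=> cL LB; have /andP[_ fL] := fin1 _ _ c0 (s0 _) cL LB.
  rewrite -leeBrDr// (lebesgue_regularity_inner_sup mA).
  apply: ge_ereal_sup => _ [K [cK KA] <-]; rewrite leeBrDr//; exact: KL.
have fA : leb A \is a fin_num.
  rewrite ge0_fin_numE//; apply: le_lt_trans Efin.
  by have := AL _ c0 (s0 _); rewrite measure0 adde0.
rewrite -(lebesgue_regularity_inner_sup mA) addeC -leeBrDr//.
apply: ge_ereal_sup => _ [L [cL LB] <-]; rewrite leeBrDr// addeC; exact: AL.
Qed.

Definition strict_hypograph d (T : measurableType d) (f : T -> \bar R) :
  set (T * measurableTypeR R) := [set z | (0 < z.2)%R && (z.2%:E < f z.1)].

Lemma measurable_strict_hypograph d (T : measurableType d) (f : T -> \bar R) :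
  measurable_fun setT f -> measurable (strict_hypograph f).
Proof.
move=> mf; rewrite /strict_hypograph.
rewrite [X in measurable X](_ : _ = [set z | (0 < z.2)%R] `&` [set z | z.2%:E < f z.1]); last first.
  by apply/seteqP; split => z /=; [move/andP|move=> [? ?]; apply/andP].
apply: measurableI.
  rewrite -[X in measurable X]setTI.
  rewrite [X in _ `&` X](_ : _ = [set z : T * measurableTypeR R | 0 < z.2%:E]).
    by apply: measurable_lte => //; exact/measurable_EFinP.
  by apply/seteqP; split => z /=; rewrite lte_fin.
rewrite -[X in measurable X]setTI; apply: measurable_lte => //.
  by apply/measurable_EFinP.
exact: measurableT_comp.
Qed.

Lemma measurable_layer d (T : measurableType d) (mu : {sigma_finite_measure set T -> \bar R})
    (f : T -> \bar R) : measurable_fun setT f ->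
  measurable_fun setT (fun t : measurableTypeR R => mu [set x | (0 < t)%R && (t%:E < f x)]).
Proof.
move=> mf; have := measurable_fun_ysection mu (measurable_strict_hypograph mf).
apply: eq_measurable_fun => t _; congr (mu _).
by apply/seteqP; split => x /=; rewrite /ysection/= inE.
Qed.

(** Both sides are the product measure of the strict hypograph of f, sliced along either factor; the
    condition 0 < t allows t to range over all of R. *)
Lemma layer_cake d (T : measurableType d) (mu : {sigma_finite_measure set T -> \bar R})
    (f : T -> \bar R) : measurable_fun setT f -> (forall x, 0 <= f x) ->
  \int[mu]_x f x = \int[leb]_t mu [set x | (0 < t)%R && (t%:E < f x)].
Proof.
move=> mf f0.
pose S := strict_hypograph f; have mS := measurable_strict_hypograph mf : measurable S.
transitivity (\int[mu]_x \int[leb]_t (\1_S (x, t))%:E).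
  apply: eq_integral => x _.
  transitivity (leb [set t | (0 < t)%R && (t%:E < f x)]).
    have := f0 x; case: (f x) => [r| |]//= r0.
    - rewrite (_ : [set _ | _] = [set` `]0%R, r[]); last first.
        by apply/seteqP; split => t /=; rewrite in_itv/= lte_fin.
      rewrite lebesgue_measure_itv/= lte_fin.
      by move: r0; rewrite lee_fin le_eqVlt => /predU1P[<-|->]; rewrite ?ltxx ?oppr0 ?adde0.
    - rewrite (_ : [set _ | _] = [set` `]0%R, +oo[]); last first.
        by apply/seteqP; split => t /=; rewrite in_itv/= ltry.
      by rewrite lebesgue_measure_itv/= ltry.
  have -> : [set t | (0 < t)%R && (t%:E < f x)] = xsection S x.
    by apply/seteqP; split => t /=; rewrite /xsection/= inE.
  rewrite -[X in leb X]setIT -integral_indic//; last exact: measurable_xsection.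
  by apply: eq_integral => t _; rewrite !indicE mem_xsection.
rewrite (@fubini_tonelli _ _ _ _ _ mu leb (fun z => (\1_S z)%:E)); last 2 first.
- by apply/measurable_EFinP; exact: measurable_indic.
- by move=> z; rewrite lee_fin.
apply: eq_integral => t _.
have -> : [set x | (0 < t)%R && (t%:E < f x)] = ysection S t.
  by apply/seteqP; split => x /=; rewrite /ysection/= inE.
rewrite -[X in mu X]setIT -integral_indic//; last exact: measurable_ysection.
by apply: eq_integral => x _; rewrite !indicE mem_ysection.
Qed.

End midpoint_inequality.

Section prekopa_leindler.
Set Implicit Arguments.
Unset Strict Implicit.
Import HBNNSimple.
Context {R : realType}.
Local Open Scope ereal_scope.
Notation leb := (@lebesgue_measure R).

(* As sup f = sup g = 1, their superlevel sets
   are nonempty at every level t < 1, where lebesgue_midpoint compares them with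
   the superlevel set of h. *)
Lemma prekopa_leindler_normalized (f g : R -> R) (h : R -> \bar R) :
  measurable_fun setT f -> measurable_fun setT g -> measurable_fun setT h ->
  (forall x, 0 <= f x <= 1)%R -> (forall x, 0 <= g x <= 1)%R -> (forall x, 0 <= h x) ->
  (forall t, t < 1 -> exists x, t < f x)%R -> (forall t, t < 1 -> exists x, t < g x)%R ->
  (forall x y, (f x * g y)%:E <= h ((x + y) / 2)%R * h ((x + y) / 2)%R) ->
  \int[leb]_x (f x)%:E + \int[leb]_x (g x)%:E <= 2%:E * \int[leb]_x h x.
Proof.
move=> mf mg mh f01 g01 h0 fsup gsup fgh.
have f0 x : (0 <= f x)%R by have /andP[] := f01 x.
have g0 x : (0 <= g x)%R by have /andP[] := g01 x.
have mf' : measurable_fun setT (EFin \o f) by exact/measurable_EFinP.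
have mg' : measurable_fun setT (EFin \o g) by exact/measurable_EFinP.
rewrite (layer_cake leb (f := EFin \o f))// (layer_cake leb (f := EFin \o g))//.
rewrite (layer_cake leb mh h0) -ge0_integralZl//; last exact: measurable_layer.
rewrite -ge0_integralD//; [|exact: measurable_layer..].
apply: ge0_le_integral => //.
- by move=> t _; exact: adde_ge0.
- by apply: emeasurable_funD; exact: measurable_layer.
- by apply: measurable_funeM; exact: measurable_layer.
have empty (k : R -> R) t : (forall x, 0 <= k x <= 1)%R -> ~~ (0 < t < 1)%R ->
    [set x | (0 < t)%R && (t%:E < (EFin \o k) x)] = set0.
  move=> k01 /negP t01; apply/seteqP; split => // x /= /andP[t0]; rewrite lte_fin => tk.
  by apply: t01; rewrite t0 (lt_le_trans tk)//; have /andP[] := k01 x.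
move=> t _; have [|t01] := boolP (0 < t < 1)%R; last first.
  by rewrite !empty// measure0 adde0 mule_ge0.
move=> /andP[t0 t1].
have [a ta] := fsup t t1; have [b tb] := gsup t t1.
have layer_meas (k : R -> \bar R) : measurable_fun setT k ->
    measurable [set x : measurableTypeR R | (0 < t)%R && (t%:E < k x)].
  move=> mk; rewrite (_ : [set _ | _] = ysection (strict_hypograph k) t); last first.
    by apply/seteqP; split => x /=; rewrite /ysection/= inE.
  by apply: measurable_ysection; exact: measurable_strict_hypograph.
apply: (lebesgue_midpoint (a := a) (b := b)) => //=.
- exact: (layer_meas (EFin \o f) mf').
- exact: (layer_meas (EFin \o g) mg').
- exact: layer_meas.
- by rewrite t0.
- by rewrite t0.
move=> x y; rewrite t0/= !lte_fin => tx ty.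
have := fgh x y; have := h0 ((x + y) / 2)%R.
case: (h _) => [r| |]//; last by rewrite ltry.
rewrite -EFinM !lee_fin lte_fin => r0 fgr; rewrite ltNge; apply/negP => rt.
have : (t * t < f x * g y)%R by apply: ltr_pM => //; exact: ltW.
by rewrite ltNge (le_trans fgr)// ler_pM.
Qed.

(** 4ab = (a + b)^2 - (a - b)^2 turns the additive bound of the normalized case into a
    multiplicative one. *)
Lemma mule_le_sqr (a b c : \bar R) : 0 <= a -> 0 <= b -> 0 <= c ->
  a + b <= 2%:E * c -> a * b <= c * c.
Proof.
case: c => [c| |] a0 b0 c0 abc; [|by rewrite mulyy leey|by rewrite leNgt ltNy0 in c0].
rewrite lee_fin in c0; rewrite -EFinM in abc *.
have : a + b < +oo by apply: le_lt_trans abc _; rewrite ltry.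
move: a b a0 b0 abc => [a| |]// [b| |]//.
rewrite -!EFinD -EFinM !lee_fin => a0 b0 abc _.
have : ((a + b) * (a + b) <= (2 * c) * (2 * c))%R by rewrite ler_pM ?addr_ge0.
have := sqr_ge0 (a - b)%R; lra.
Qed.

Lemma prekopa_leindler_bounded (f g : R -> R) (h : R -> \bar R) (M : R) :
  measurable_fun setT f -> measurable_fun setT g -> measurable_fun setT h ->
  (forall x, 0 <= f x <= M)%R -> (forall x, 0 <= g x <= M)%R -> (forall x, 0 <= h x) ->
  (forall x y, (f x * g y)%:E <= h ((x + y) / 2)%R * h ((x + y) / 2)%R) ->
  (\int[leb]_x (f x)%:E) * (\int[leb]_x (g x)%:E) <=
  (\int[leb]_x h x) * (\int[leb]_x h x).
Proof.
move=> mf mg mh fM gM h0 fgh.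
have f0 x : (0 <= f x)%R by have /andP[] := fM x.
have g0 x : (0 <= g x)%R by have /andP[] := gM x.
have supP (k : R -> R) : (forall x, 0 <= k x <= M)%R ->
    (forall x, k x = 0)%R \/ exists s, [/\ (0 < s)%R, forall x, (0 <= k x / s <= 1)%R &
    (forall t, t < 1 -> exists x, t < k x / s)%R].
  move=> kM; have hsk : has_sup (range k).
    by split; [exists (k 0%R), 0%R|exists M => _ [x _ <-]; have /andP[] := kM x].
  have kle x : (k x <= sup (range k))%R by apply: ub_le_sup; [case: hsk|exists x].
  have k0 x : (0 <= k x)%R by have /andP[] := kM x.
  have := le_trans (k0 0%R) (kle 0%R); rewrite le_eqVlt => /predU1P[s0|s0].
    by left => x; apply/eqP; rewrite eq_le k0 andbT s0.
  right; exists (sup (range k)); split => // [x|t t1].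
    by rewrite divr_ge0// ?(ltW s0)//= ler_pdivrMr// mul1r.
  have e0 : (0 < (1 - t) * sup (range k))%R by rewrite mulr_gt0// subr_gt0.
  have [_ [x _ <-]] := sup_adherent e0 hsk.
  rewrite mulrBl mul1r subKr => tk; exists x; by rewrite ltr_pdivlMr.
have [f00|[a [a0 fa fsup]]] := supP f fM.
  rewrite (eq_integral (cst 0)) ?integral0 ?mul0e ?mule_ge0 ?integral_ge0//.
  by move=> x _; rewrite f00.
have [g00|[b [b0 gb gsup]]] := supP g gM.
  rewrite [X in _ * X](eq_integral (cst 0)) ?integral0 ?mule0 ?mule_ge0 ?integral_ge0//.
  by move=> x _; rewrite g00.
(* The hypothesis is bilinear in f, g and quadratic in h: dividing f and g by their suprema a and b
   means dividing h by sqrt (ab). *)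
pose c := Num.sqrt (a * b).
have c0 : (0 < c)%R by rewrite sqrtr_gt0 mulr_gt0.
have cc : (c * c = a * b)%R by rewrite -expr2 sqr_sqrtr// mulr_ge0// ltW.
have ge0E (k : R -> R) : (forall x, 0 <= k x)%R -> forall x, 0 <= (k x)%:E.
  by move=> k0 x; rewrite lee_fin.
have Zl (k : R -> R) s : (0 < s)%R -> (forall x, 0 <= k x)%R -> measurable_fun setT k ->
    \int[leb]_x (k x / s)%:E = (s^-1)%:E * \int[leb]_x (k x)%:E.
  move=> s0 k0 mk; rewrite -ge0_integralZl//.
  - by apply: eq_integral => x _; rewrite -EFinM mulrC.
  - exact/measurable_EFinP.
  - by move=> x _; rewrite lee_fin.
  - by rewrite lee_fin invr_ge0 ltW.
have ch0 x : 0 <= (c^-1)%:E * h x by rewrite mule_ge0// lee_fin invr_ge0 ltW.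
have := @prekopa_leindler_normalized (fun x => f x / a)%R (fun x => g x / b)%R
  (fun x => (c^-1)%:E * h x).
rewrite Zl// Zl// ge0_integralZl//; last by rewrite lee_fin invr_ge0 ltW.
set If := \int[leb]_x (f x)%:E; set Ig := \int[leb]_x (g x)%:E; set Ih := \int[leb]_x h x.
move=> PL.
have If0 : 0 <= If by apply: integral_ge0 => x _; exact: ge0E.
have Ig0 : 0 <= Ig by apply: integral_ge0 => x _; exact: ge0E.
have Ih0 : 0 <= Ih by apply: integral_ge0.
have /mule_le_sqr : (a^-1)%:E * If + (b^-1)%:E * Ig <= 2%:E * ((c^-1)%:E * Ih).
  apply: PL => //.
  - exact: measurable_funM.
  - exact: measurable_funM.
  - exact: measurable_funeM.
  move=> x y; have := fgh x y; have := h0 ((x + y) / 2)%R.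
  case: (h _) => [r| |] r0; last by rewrite leNgt ltNy0 in r0.
    rewrite -!EFinM !lee_fin => fgr.
    have -> : (c^-1 * r * (c^-1 * r) = r * r / (a * b))%R.
      by rewrite -cc; field; rewrite gt_eqF.
    have -> : (f x / a * (g y / b) = f x * g y / (a * b))%R.
      by field; rewrite !gt_eqF.
    by rewrite ler_pM2r// invr_gt0 mulr_gt0.
  by move=> _; rewrite !gt0_muley ?lte_fin ?invr_gt0// leey.
have ia0 : 0 <= (a^-1)%:E by rewrite lee_fin invr_ge0 ltW.
have ib0 : 0 <= (b^-1)%:E by rewrite lee_fin invr_ge0 ltW.
have ic0 : 0 <= (c^-1)%:E by rewrite lee_fin invr_ge0 ltW.
move=> /(_ (mule_ge0 ia0 If0) (mule_ge0 ib0 Ig0) (mule_ge0 ic0 Ih0)).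
rewrite muleACA [leRHS]muleACA -!EFinM -!invfM cc.
by rewrite lee_pmul2l// lte_fin invr_gt0 mulr_gt0.
Qed.

Lemma nnsfun_approx_bounded (f : R -> \bar R) (mf : measurable_fun setT f) n :
  exists M : R, forall x, (0 <= nnsfun_approx measurableT mf n x <= M)%R.
Proof.
have [M [_ /= bM]] := simple_bounded (nnsfun_approx measurableT mf n).
exists (M + 1)%R => x; rewrite fun_ge0/=.
by apply: le_trans (ler_norm _) _; apply: bM => //; rewrite ltrDl.
Qed.

Lemma prekopa_leindler1 (f g h : R -> \bar R) :
  measurable_fun setT f -> measurable_fun setT g -> measurable_fun setT h ->
  (forall x, 0 <= f x) -> (forall x, 0 <= g x) -> (forall x, 0 <= h x) ->
  (forall x y, f x * g y <= h ((x + y) / 2)%R * h ((x + y) / 2)%R) ->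
  (\int[leb]_x f x) * (\int[leb]_x g x) <= (\int[leb]_x h x) * (\int[leb]_x h x).
Proof.
move=> mf mg mh f0 g0 h0 fgh.
have If0 : 0 <= \int[leb]_x f x by apply: integral_ge0.
have Ig0 : 0 <= \int[leb]_x g x by apply: integral_ge0.
have Ih0 : 0 <= \int[leb]_x h x by apply: integral_ge0.
(* With both integrals nonzero, the product of the two limits is not of the form 0 times +oo, as its
   continuity in [cfg] requires. *)
have [If00|Ifgt0] := eqVneq (\int[leb]_x f x) 0.
  by rewrite If00 mul0e mule_ge0.
have [Ig00|Iggt0] := eqVneq (\int[leb]_x g x) 0.
  by rewrite Ig00 mule0 mule_ge0.
pose f_ := nnsfun_approx measurableT mf; pose g_ := nnsfun_approx measurableT mg.
have approx_le (k : R -> \bar R) (mk : measurable_fun setT k) n x : (forall x, 0 <= k x) ->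
    (nnsfun_approx measurableT mk n x)%:E <= k x.
  move=> k0; have kc := @cvg_nnsfun_approx _ _ _ _ measurableT _ mk (fun x _ => k0 x) x I.
  rewrite -(cvg_lim _ kc)//; apply: lime_ge; first by apply/cvg_ex; eexists; exact: kc.
  by exists n => // i /= ni; rewrite lee_fin; exact/lefP/nd_nnsfun_approx.
have cvg_int (k : R -> \bar R) (mk : measurable_fun setT k) : (forall x, 0 <= k x) ->
    \int[leb]_x (nnsfun_approx measurableT mk n x)%:E @[n --> \oo] --> \int[leb]_x k x.
  move=> k0.
  have -> : \int[leb]_x k x =
      \int[leb]_x limn (fun n => (nnsfun_approx measurableT mk n x)%:E).
    by apply: eq_integral => x _; apply/esym/cvg_lim => //; exact: cvg_nnsfun_approx.
  apply: cvg_monotone_convergence => //.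
  - by move=> n; apply/measurable_EFinP; exact: (measurable_funP (nnsfun_approx measurableT mk n)).
  - by move=> n x _; rewrite lee_fin.
  - by move=> x _ i j ij; rewrite lee_fin; exact/lefP/(nd_nnsfun_approx measurableT mk).
have cfg : (\int[leb]_x (f_ n x)%:E) * (\int[leb]_x (g_ n x)%:E) @[n --> \oo] -->
    (\int[leb]_x f x) * (\int[leb]_x g x).
  apply: cvgeM; [|exact: cvg_int|exact: cvg_int].
  by apply: neq0_mule_def; rewrite mule_neq0.
rewrite -(cvg_lim _ cfg)//; apply: lime_le.
  by apply/cvg_ex; eexists; exact: cfg.
apply: nearW => n.
have [M1 fM] := nnsfun_approx_bounded mf n; have [M2 gM] := nnsfun_approx_bounded mg n.
apply: (@prekopa_leindler_bounded _ _ _ (Num.max M1 M2)) => //.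
- by move=> x; have /andP[-> fx] := fM x; rewrite le_max fx.
- by move=> x; have /andP[-> gx] := gM x; rewrite le_max gx orbT.
move=> x y; apply: le_trans (fgh x y); rewrite EFinM.
by apply: lee_pmul; rewrite ?lee_fin//; exact: approx_le.
Qed.

(** Tensorisation: for fixed first coordinates s and t, the induction hypothesis on the slices says
    that the marginals satisfy the one-dimensional hypothesis. Writing h * h instead of a square
    root gives hypothesis and conclusion the same shape in [\bar R]. *)
Lemma prekopa_leindler n (f g h : 'cV[R]_n -> \bar R) :
  measurable_fun setT f -> measurable_fun setT g -> measurable_fun setT h ->
  (forall x, 0 <= f x) -> (forall x, 0 <= g x) -> (forall x, 0 <= h x) ->
  (forall x y, f x * g y <= h (2^-1 *: (x + y))%R * h (2^-1 *: (x + y))%R) ->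
  (\int[lebesgue_cV n]_x f x) * (\int[lebesgue_cV n]_x g x) <=
  (\int[lebesgue_cV n]_x h x) * (\int[lebesgue_cV n]_x h x).
Proof.
elim: n f g h => [|n IH] f g h mf mg mh f0 g0 h0 fgh.
  rewrite !integral_lebesgue_cV0//; have := fgh 0%R 0%R.
  by rewrite addr0 scaler0.
rewrite !integral_lebesgue_cVS//.
have mcons (k : 'cV[R]_n.+1 -> \bar R) : measurable_fun setT k ->
    measurable_fun setT (k \o @cons_cV R n).
  by move=> mk; apply: measurableT_comp => //; exact: measurable_cons_cV.
have mslice (k : 'cV[R]_n.+1 -> \bar R) s : measurable_fun setT k ->
    measurable_fun setT (fun v => k (cons_cV (s, v))).
  move=> mk; apply: (measurableT_comp (mcons _ mk) (g := fun v => (s, v))).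
  exact: measurable_fun_pair.
have mmarg (k : 'cV[R]_n.+1 -> \bar R) : measurable_fun setT k -> (forall x, 0 <= k x) ->
    measurable_fun setT (fun s : R => \int[lebesgue_cV n]_v k (cons_cV (s, v))).
  move=> mk k0.
  exact: (measurable_fun_fubini_tonelli_F (m2 := lebesgue_cV n) _ (mcons _ mk) (fun=> k0 _)).
apply: prekopa_leindler1; try exact: mmarg; try by move=> s; apply: integral_ge0.
move=> s t; apply: IH => //; try exact: mslice.
move=> x y; apply: le_trans (fgh _ _) _.
rewrite (_ : cons_cV (((s + t) / 2)%R, _) = 2^-1 *: (cons_cV (s, x) + cons_cV (t, y)))%R//.
by rewrite -(cons_cVD (s, x) (t, y)) -(cons_cVZ _ (_, _))/= mulrC.
Qed.

End prekopa_leindler.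

(** * Quadratic forms *)

Section bilinear_form.
Set Implicit Arguments.
Unset Strict Implicit.
Context {R : realType}.

Definition bform n (M : 'M[R]_n) (x y : 'cV[R]_n) : R := (x^T *m M *m y) 0 0.

Definition dot n (a x : 'cV[R]_n) : R := (a^T *m x) 0 0.

Lemma bformDl n (M : 'M[R]_n) x y z : bform M (x + y) z = bform M x z + bform M y z.
Proof. by rewrite /bform linearD/= !mulmxDl mxE. Qed.

Lemma bformDr n (M : 'M[R]_n) x y z : bform M x (y + z) = bform M x y + bform M x z.
Proof. by rewrite /bform mulmxDr mxE. Qed.

Lemma bformZl n (M : 'M[R]_n) c x y : bform M (c *: x) y = c * bform M x y.
Proof. by rewrite /bform linearZ/= -!scalemxAl mxE. Qed.

Lemma bformZr n (M : 'M[R]_n) c x y : bform M x (c *: y) = c * bform M x y.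
Proof. by rewrite /bform -scalemxAr mxE. Qed.

Lemma bformNl n (M : 'M[R]_n) x y : bform M (- x) y = - bform M x y.
Proof. by rewrite -scaleN1r bformZl mulN1r. Qed.

Lemma bformNr n (M : 'M[R]_n) x y : bform M x (- y) = - bform M x y.
Proof. by rewrite -scaleN1r bformZr mulN1r. Qed.

Lemma bformC n (M : 'M[R]_n) x y : M^T = M -> bform M x y = bform M y x.
Proof.
move=> MT; rewrite /bform -[in LHS](trmxK (x^T *m M *m y)) mxE.
by rewrite !trmx_mul trmxK MT mulmxA.
Qed.

Definition bformE := (bformDl, bformDr, bformZl, bformZr, bformNl, bformNr).

Lemma dotE n (a x : 'cV[R]_n) : dot a x = \sum_i a i 0 * x i 0.
Proof. by rewrite /dot mxE; apply: eq_bigr => i _; rewrite mxE. Qed.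

Lemma dotD n (a x y : 'cV[R]_n) : dot a (x + y) = dot a x + dot a y.
Proof. by rewrite /dot mulmxDr mxE. Qed.

Lemma dotZ n c (a x : 'cV[R]_n) : dot a (c *: x) = c * dot a x.
Proof. by rewrite /dot -scalemxAr mxE. Qed.

Lemma dotN n (a x : 'cV[R]_n) : dot a (- x) = - dot a x.
Proof. by rewrite -scaleN1r dotZ mulN1r. Qed.

Lemma dotC n (a x : 'cV[R]_n) : dot a x = dot x a.
Proof. by rewrite !dotE; apply: eq_bigr => i _; rewrite mulrC. Qed.

Lemma dotZl n c (a x : 'cV[R]_n) : dot (c *: a) x = c * dot a x.
Proof. by rewrite dotC dotZ dotC. Qed.

Lemma dot_ge0 n (x : 'cV[R]_n) : 0 <= dot x x.
Proof. by rewrite dotE sumr_ge0// => i _; rewrite -expr2 sqr_ge0. Qed.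

Lemma dot_eq0 n (x : 'cV[R]_n) : dot x x = 0 -> x = 0.
Proof.
rewrite dotE => /eqP; rewrite psumr_eq0; last by move=> i _; rewrite -expr2 sqr_ge0.
move=> /allP x0; apply/matrixP => i j; rewrite (ord1 j) mxE.
by apply/eqP; rewrite -sqrf_eq0 expr2; apply: x0; rewrite mem_index_enum.
Qed.

Lemma bform_mulr n (M : 'M[R]_n) x y : bform M x y = dot x (M *m y).
Proof. by rewrite /bform /dot mulmxA. Qed.

Lemma posdefmx_semidef n (M : 'M[R]_n) : posdefmx M -> possemidefmx M.
Proof.
move=> [MT M0]; split => // x; have [->|x0] := eqVneq x 0; last exact/ltW/M0.
by rewrite mulmx0 mxE.
Qed.

(** If x'Mx = 0, the form at y + t x is affine in t and nonnegative for all t, hence constant; so M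
    x is orthogonal to every y, and x = 0 by invertibility. *)
Lemma possemidefmx_unit n (M : 'M[R]_n) : possemidefmx M -> M \in unitmx -> posdefmx M.
Proof.
move=> [MT M0] uM; split => // x x0; rewrite lt_neqAle M0 andbT eq_sym.
apply: contraNneq x0 => xMx.
have Mx0 y : bform M x y = 0.
  have b0 : 0 <= bform M y y by exact: M0.
  have q t : 0 <= bform M y y + 2 * t * bform M x y.
    have := M0 (y + t *: x); rewrite -/(bform _ _ _) !bformE (bformC y x MT).
    by rewrite (_ : bform M x x = 0)//; lra.
  apply/eqP; apply: contraT => bxy.
  (* At this t the affine function is equal to -1. *)
  have := q (- (bform M y y + 1) / (2 * bform M x y)).
  rewrite (_ : 2 * _ * _ = - (bform M y y + 1)); last by field.
  by lra.
have : M *m x = 0.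
  apply: dot_eq0; have := Mx0 (M *m x).
  by rewrite bformC// bform_mulr.
by move=> /(congr1 (mulmx (invmx M))); rewrite mulKmx// mulmx0 => ->.
Qed.

Lemma posdefmx_unit n (M : 'M[R]_n) : posdefmx M -> M \in unitmx.
Proof.
move=> [MT M0]; rewrite -row_free_unit; apply: inj_row_free => v vM.
apply/eqP; apply: contraT => v0.
have : v^T != 0 by apply: contraNneq v0 => /(congr1 trmx); rewrite trmxK trmx0 => ->.
by move=> /M0; rewrite trmxK vM mul0mx mxE ltxx.
Qed.

Lemma posdefmx_inv n (M : 'M[R]_n) : posdefmx M -> posdefmx (invmx M).
Proof.
move=> /[dup] /posdefmx_unit uM [MT M0].
have iT : (invmx M)^T = invmx M by rewrite trmx_inv MT.
split => // x x0.
have : invmx M *m x != 0.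
  by apply: contraNneq x0 => /(congr1 (mulmx M)); rewrite mulKVmx// mulmx0 => ->.
by move=> /M0; rewrite trmx_mul iT -!mulmxA mulKVmx// mulmxA.
Qed.

Lemma posdefmx_drsub d m (A : 'M[R]_d) (B : 'M[R]_(d, m)) (C : 'M[R]_m) :
  posdefmx (block_mx A B B^T C) -> posdefmx C.
Proof.
move=> [ST S0]; split.
  by move: ST; rewrite tr_block_mx => /eq_block_mx[].
move=> x x0; have : col_mx (0 : 'cV[R]_d) x != 0.
  apply: contraNneq x0 => /eqP; rewrite col_mx_eq0 => /andP[_ /eqP ->].
  by [].
move=> /S0; rewrite tr_col_mx mul_row_block mul_row_col !trmx0 !mul0mx !add0r.
by rewrite mulmx0 add0r.
Qed.

(** Completing the square: a shift along M a produces cross terms free of the inverse. At t = 1 this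
    gives the Cameron-Martin density, and at 4 t the exponent needed for the tilted masses. *)
Lemma bform_inv_shift n (M : 'M[R]_n) (a w : 'cV[R]_n) (t : R) : posdefmx M ->
  bform (invmx M) (w - t *: (M *m a)) (w - t *: (M *m a)) =
  bform (invmx M) w w - 2 * t * dot a w + t ^+ 2 * bform M a a.
Proof.
move=> pM; have [iT _] := posdefmx_inv pM; have uM := posdefmx_unit pM.
rewrite !bformE (bformC (M *m a) w iT) !(bform_mulr (invmx M) _ (M *m a)) mulKmx//.
rewrite (dotC w) (dotC (M *m a)) -bform_mulr; ring.
Qed.

End bilinear_form.

(** * Elementary bounds on the exponential *)

Section expR_inequalities.
Context {R : realType}.
Implicit Type x : R.

Lemma expR_sub1_le x : x < 1 -> expR x - 1 <= x / (1 - x).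
Proof.
move=> x1; have := expR_ge1Dx (- x); rewrite expRN => h.
have e0 := expR_gt0 x; have x0 : 0 < 1 - x by rewrite subr_gt0.
rewrite lerBlDr (_ : x / (1 - x) + 1 = (1 - x)^-1); last by field; rewrite gt_eqF.
by rewrite -[leLHS]invrK lef_pV2// posrE invr_gt0.
Qed.

Lemma expR_subN_ge x : 0 <= x -> 2 * x <= expR x - expR (- x).
Proof.
rewrite le_eqVlt => /predU1P[<-|x0]; first by rewrite oppr0 subrr mulr0.
pose g : R -> R := fun y => expR y - expR (- y).
have dg (y : R) : is_derive y 1 g (expR y + expR (- y)).
  have dn : is_derive y 1 (fun z : R => expR (- z)) (- expR (- y)).
    have := is_derive1_comp (is_derive_expR (- y)) (is_deriveNid y 1).
    by rewrite mulrN1.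
  rewrite -[X in is_derive _ _ _ (_ + X)]opprK.
  exact: (is_deriveB (is_derive_expR y) dn).
have [|c _] := @MVT R g _ 0 x x0 (fun y _ => dg y).
  apply: derivable_within_continuous => y _; have [] := dg y.
  by [].
rewrite /g subr0 expR0 oppr0 expR0 subrr subr0 => ->.
rewrite ler_pM2r//; have e0 := expR_gt0 c; rewrite expRN.
have : 0 <= (expR c - 1) ^+ 2 / expR c by rewrite divr_ge0 ?sqr_ge0 ?ltW.
rewrite (_ : _ / _ = expR c + (expR c)^-1 - 2); last by field; rewrite gt_eqF.
by rewrite subr_ge0.
Qed.

(** 2 cosh x - 2 is the square of 2 sinh (x / 2), which is at least x for x >= 0. *)
Lemma expR_addN_ge x : 2 + x ^+ 2 <= expR x + expR (- x).
Proof.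
wlog x0 : x / 0 <= x.
  move=> h; have [/h//|/ltW] := leP 0 x.
  by rewrite -oppr_ge0 => /h; rewrite sqrrN opprK addrC [X in _ <= X]addrC addrC.
have := @expR_subN_ge (x / 2); rewrite divr_ge0// => /(_ isT).
rewrite mulrC divfK// => xle.
have : x ^+ 2 <= (expR (x / 2) - expR (- (x / 2))) ^+ 2.
  by rewrite ler_sqr// nnegrE ?(le_trans x0).
have e1 : expR (x / 2) * expR (- (x / 2)) = 1 by rewrite expRN divff// gt_eqF ?expR_gt0.
have e2 : expR x = expR (x / 2) ^+ 2 by rewrite expr2 -expRD; congr expR; field.
have e3 : expR (- x) = expR (- (x / 2)) ^+ 2 by rewrite expr2 -expRD; congr expR; field.
rewrite e2 e3; nra.
Qed.

End expR_inequalities.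

(** * Variance of a truncated Gaussian *)

Section gaussian_symmetric.
Set Implicit Arguments.
Unset Strict Implicit.
Context {R : realType}.
Implicit Types n : nat.

Lemma measurable_dot n (a : 'cV[R]_n) : measurable_fun setT (dot a).
Proof.
apply: (measurableT_comp (measurable_coord 0 0)).
exact: measurable_mulmx.
Qed.

Lemma measurable_bform n (M : 'M[R]_n) : measurable_fun setT (fun x => bform M x x).
Proof.
apply: (measurableT_comp (measurable_coord 0 0)).
apply: measurable_mulmx => //; apply: measurable_mulmx => //.
exact: measurable_trmx.
Qed.

Lemma bform_parallelogram n (M : 'M[R]_n) x y : M^T = M ->
  bform M x x + bform M y y =
  2 * bform M (2^-1 *: (x + y)) (2^-1 *: (x + y)) + bform M (x - y) (x - y) / 2.
Proof. by move=> MT; rewrite !bformE (bformC y x MT); field. Qed.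

Lemma mule_sqr_le (x y : \bar R) :
  (0 <= x -> 0 <= y -> x * x <= y * y -> x <= y)%E.
Proof.
case: x => [x| |]; case: y => [y| |] //=; rewrite ?leey//.
by rewrite -!EFinM !lee_fin -!expr2 => x0 y0; rewrite ler_sqr.
Qed.

Variables (n : nat) (Gamma : 'M[R]_n) (Gamma_pos : posdefmx Gamma) (a : 'cV[R]_n).
Notation Q x := (bform (invmx Gamma) x x).
Notation sigma2 := (bform Gamma a a).
Local Open Scope ereal_scope.
Notation "\int_ x f" := (\int[lebesgue_cV n]_x f) (at level 36, x name, f at level 36).

Variable K : set 'cV[R]_n.
Hypothesis mK : measurable K.
Hypothesis K_sym : forall x, K x -> K (- x)%R.
Hypothesis K_mid : forall x y, K x -> K y -> K (2^-1 *: (x + y))%R.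

(** Unnormalised density of N(0, 2 Gamma) restricted to K, the quadratic form of (2 Gamma)^-1 being
    Q / 2. *)
Let k (u : 'cV[R]_n) : R := (\1_K u * expR (- Q u / 4))%R.

Let k_ge0 u : (0 <= k u)%R.
Proof. by rewrite mulr_ge0 ?expR_ge0// indicE. Qed.

Let measurable_k : measurable_fun setT k.
Proof.
apply: measurable_funM; first exact: measurable_indic.
apply: (measurableT_comp (measurable_expR (R := R))); apply: measurable_funM => //.
by apply: measurableT_comp => //; exact: measurable_bform.
Qed.

Let kN u : k (- u) = k u.
Proof.
rewrite /k bformNl bformNr opprK; congr (_ * _)%R; rewrite !indicE; congr (_ %:R).
by congr nat_of_bool; apply/idP/idP; rewrite !inE => /K_sym; rewrite ?opprK.
Qed.

(* Prekopa-Leindler for the tilts by t and - t, whose masses agree by symmetry of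
   K; completing the square in x - y - 4 t Gamma a gives the factor. *)
Let tilted_mass_le (t : R) :
  \int_u (k u * expR (t * dot a u))%:E <= (expR (t ^+ 2 * sigma2))%:E * \int_u (k u)%:E.
Proof.
pose f s u := (k u * expR (s * dot a u))%:E : \bar R.
have mf s : measurable_fun setT (f s).
  apply/measurable_EFinP; apply: measurable_funM => //.
  apply: (measurableT_comp (measurable_expR (R := R))); apply: measurable_funM => //.
  exact: measurable_dot.
have f0 s u : 0 <= f s u by rewrite lee_fin mulr_ge0 ?expR_ge0.
have fN : \int_u f (- t)%R u = \int_u f t u.
  have n1 : (-1 != 0 :> R)%R by rewrite oppr_eq0 oner_neq0.
  rewrite (ge0_integral_affine_cV 0%R n1 (mf (- t)%R) (f0 _)).
  rewrite normrN1 expr1n mul1e; apply: eq_integral => u _.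
  by rewrite scaleN1r addr0 /f kN dotN mulrNN.
(* The factor is the moment generating function at t of a . u for u of law N(0, 2 Gamma), since a .
   u then has variance 2 sigma2. *)
pose h u := ((expR (t ^+ 2 * sigma2))%:E * (k u)%:E).
have mk : measurable_fun setT (EFin \o k) by exact/measurable_EFinP.
have h0 u : 0 <= h u by rewrite mule_ge0// lee_fin ?expR_ge0.
have PL : (\int_u f t u) * (\int_u f (- t)%R u) <= (\int_u h u) * (\int_u h u).
  apply: prekopa_leindler => //; first by apply: measurable_funeM.
  move=> x y; rewrite /f /h -!EFinM lee_fin /k !indicE.
  have [Kx|] := boolP (x \in K); last by rewrite !mul0r !mulr_ge0// expR_ge0.
  have [Ky|] := boolP (y \in K); last by rewrite !mul0r mulr0 !mulr_ge0// expR_ge0.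
  have -> : (2^-1 *: (x + y))%R \in K by move: Kx Ky; rewrite !inE => *; exact: K_mid.
  rewrite !mul1r -!expRD ler_expR.
  have [iT _] := posdefmx_inv Gamma_pos.
  have [_ /(_ (x - y - (4 * t) *: (Gamma *m a))%R)] := posdefmx_semidef (posdefmx_inv Gamma_pos).
  rewrite -/(bform _ _ _) bform_inv_shift// dotD dotN.
  have := bform_parallelogram x y iT.
  by lra.
have hE : \int_u h u = (expR (t ^+ 2 * sigma2))%:E * \int_u (k u)%:E.
  by rewrite /h ge0_integralZl// => u _; rewrite lee_fin.
rewrite hE fN in PL.
apply: mule_sqr_le PL; first exact: integral_ge0.
by rewrite mule_ge0 ?lee_fin ?expR_ge0// integral_ge0// => u _; rewrite lee_fin.
Qed.

(* Second order expansion of tilted_mass_le at t = 0, with t ^+ 2 = e / sigma2. *)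
Let second_moment_le (e : R) : (0 < sigma2)%R -> (0 < e < 1)%R ->
  (1 - e)%:E * \int_u (dot a u ^+ 2 * k u)%:E <= (2 * sigma2)%:E * \int_u (k u)%:E.
Proof.
move=> s0 /andP[e0 e1].
have mk : measurable_fun setT (EFin \o k) by exact/measurable_EFinP.
have mdk : measurable_fun setT (fun u => (dot a u ^+ 2 * k u)%:E).
  apply/measurable_EFinP; apply: measurable_funM => //.
  by apply: measurable_funX; exact: measurable_dot.
have [M0fin|] := ltP (\int_u (k u)%:E) +oo; last first.
  by rewrite leye_eq => /eqP ->; rewrite gt0_muley ?leey// lte_fin mulr_gt0.
pose t := Num.sqrt (e / sigma2).
have t2 : (t ^+ 2 * sigma2 = e)%R.
  by rewrite sqr_sqrtr ?divr_ge0 ?ltW// divfK// gt_eqF.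
have t20 : (0 < t ^+ 2)%R by rewrite -(pmulr_lgt0 _ s0) t2.
have mexp s : measurable_fun setT (fun u => (k u * expR (s * dot a u))%:E).
  apply/measurable_EFinP; apply: measurable_funM => //.
  apply: (measurableT_comp (measurable_expR (R := R))); apply: measurable_funM => //.
  exact: measurable_dot.
have k0 u : 0 <= (k u)%:E by rewrite lee_fin.
have dk0 u : 0 <= (dot a u ^+ 2 * k u)%:E by rewrite lee_fin mulr_ge0// sqr_ge0.
have e0' s u : 0 <= (k u * expR (s * dot a u))%:E by rewrite lee_fin mulr_ge0 ?expR_ge0.
have : \int_u (2%:E * (k u)%:E + (t ^+ 2)%:E * (dot a u ^+ 2 * k u)%:E) <=
    \int_u ((k u * expR (t * dot a u))%:E + (k u * expR (- t * dot a u))%:E).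
  apply: ge0_le_integral => //.
  - by move=> u _; rewrite adde_ge0// mule_ge0// lee_fin ltW.
  - by apply: emeasurable_funD; apply: measurable_funeM.
  - exact: emeasurable_funD.
  move=> u _; rewrite -!EFinM -!EFinD lee_fin.
  have := @expR_addN_ge R (t * dot a u); rewrite -mulNr => h.
  have := ler_wpM2l (k_ge0 u) h; rewrite exprMn; lra.
rewrite !ge0_integralD//; last 4 first.
- by move=> u _; rewrite mule_ge0.
- exact: measurable_funeM.
- by move=> u _; rewrite mule_ge0// lee_fin ltW.
- exact: measurable_funeM.
rewrite !ge0_integralZl ?lee_fin ?(ltW t20)//.
have := tilted_mass_le t; have := tilted_mass_le (- t); rewrite sqrrN t2.
move=> /[swap] /leeD /[apply] + h; move=> /(le_trans h).
have : 0 <= \int_u (dot a u ^+ 2 * k u)%:E by apply: integral_ge0.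
have : 0 <= \int_u (k u)%:E by apply: integral_ge0.
move: (\int_u (k u)%:E) M0fin (\int_u (dot a u ^+ 2 * k u)%:E) => [A| |]// _ [B| |]//.
- rewrite -!EFinM -!EFinD !lee_fin => A0 B0 AB.
  (* The bound e / (1 - e) on expR e - 1 is the source of the factor 1 - e in the statement. *)
  have := expR_sub1_le e1; rewrite ler_pdivlMr ?subr_gt0// => h1.
  have : (t ^+ 2 * B <= 2 * (expR e - 1) * A)%R by lra.
  have -> : (t ^+ 2 = e / sigma2)%R by rewrite -t2 mulfK// gt_eqF.
  rewrite mulrAC ler_pdivrMr// => h2.
  rewrite -(ler_pM2l e0).
  have h3 : (0 <= 2 * sigma2 * A)%R by rewrite !mulr_ge0// ltW.
  have := ler_wpM2l h3 h1.
  have e10 : (0 <= 1 - e)%R by rewrite subr_ge0 ltW.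
  have := ler_wpM2r e10 h2.
  lra.
- by move=> _ _; rewrite gt0_muley ?lte_fin// addey.
Qed.

(** The limit e -> 0 of [second_moment_le], argued by contradiction: if the left side B exceeded the
    right side C, then e = (B - C) / (2 B) would make (1 - e) B the mean of B and C, still larger
    than C. For infinite B, e = 1 / 2 is enough. *)
Lemma gaussian_symmetric_variance : (0 < sigma2)%R ->
  \int_u (dot a u ^+ 2 * k u)%:E <= (2 * sigma2)%:E * \int_u (k u)%:E.
Proof.
move=> s0; have H e := second_moment_le (e := e) s0.
have : 0 <= \int_u (dot a u ^+ 2 * k u)%:E.
  by apply: integral_ge0 => u _; rewrite lee_fin mulr_ge0// sqr_ge0.
have : 0 <= (2 * sigma2)%:E * \int_u (k u)%:E.
  apply: mule_ge0; first by rewrite lee_fin mulr_ge0// ltW.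
  by apply: integral_ge0 => u _; rewrite lee_fin.
move: (\int_u (dot a u ^+ 2 * k u)%:E) (_ * _) H => [B| |] [C| |]//=; rewrite ?leey//.
- rewrite !lee_fin => H C0 B0; rewrite leNgt; apply/negP => CB.
  have B0' : (0 < B)%R by apply: le_lt_trans CB.
  have := H ((B - C) / (2 * B))%R; rewrite -EFinM lee_fin.
  rewrite divr_gt0 ?mulr_gt0 ?subr_gt0//= ltr_pdivrMr ?mulr_gt0// mul1r.
  rewrite (_ : (1 - _) * B = (B + C) / 2)%R; last by field; rewrite gt_eqF.
  by move=> /(_ ltac:(lra)); lra.
- move=> H _ _; have := H 2^-1%R; rewrite gt0_muley ?lte_fin ?subr_gt0 ?invf_lt1 ?ltr1n//.
  by rewrite invr_gt0 ltr0n/= => /(_ isT); rewrite leye_eq.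
Qed.

End gaussian_symmetric.

(** * Symmetrisation over the orthant and strictness *)

Section orthant_variance.
Set Implicit Arguments.
Unset Strict Implicit.
Context {R : realType}.
Local Open Scope ereal_scope.

(** For l = tau this is the cube of side c at the vertex - tau of the orthant x + tau > 0. *)
Definition box_cV n (l : 'cV[R]_n) (c : R) : set 'cV[R]_n :=
  [set x | forall i, (0 < x i 0 + l i 0 < c)%R].

Lemma measurable_forall_coord n (E : 'I_n -> set R) :
  (forall i, measurable (E i)) -> measurable [set x : 'cV[R]_n | forall i, E i (x i 0%R)].
Proof.
move=> mE; rewrite [X in measurable X](_ : _ =
    \bigcap_(i in [set: 'I_n]) ((fun x : 'cV[R]_n => x i 0%R) @^-1` E i)); last first.
  by apply/seteqP; split => x /= h i; [move=> _; exact: h|exact: h i I].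
apply: fin_bigcap_measurable => // i _.
by rewrite -[X in measurable X]setTI; exact: measurable_coord.
Qed.

Lemma measurable_box_cV n (l : 'cV[R]_n) c : measurable (box_cV l c).
Proof.
apply: (@measurable_forall_coord n (fun i => [set y | (0 < y + l i 0 < c)%R])) => i.
rewrite (_ : [set _ | _] = [set` `](- l i 0)%R, (c - l i 0)%R[]) //.
by apply/seteqP; split => y /=; rewrite in_itv/= => /andP[? ?]; apply/andP; split; lra.
Qed.

Lemma lebesgue_box_cV n (l : 'cV[R]_n) (c : R) : (0 < c)%R ->
  lebesgue_cV n (box_cV l c) = (c ^+ n)%:E.
Proof.
move=> c0; rewrite -[X in lebesgue_cV n X]setIT -integral_indic//; last exact: measurable_box_cV.
elim: n l => [|n IH] l.
  rewrite integral_lebesgue_cV0; last first.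
    by apply/measurable_EFinP/measurable_indic; exact: measurable_box_cV.
  by rewrite indicE mem_set// => -[].
rewrite integral_lebesgue_cVS; last 2 first.
- by apply/measurable_EFinP/measurable_indic; exact: measurable_box_cV.
- by move=> x; rewrite lee_fin.
pose I := [set` `](- l ord0 0)%R, (c - l ord0 0)%R[] : set R.
transitivity (\int[lebesgue_measure]_s ((c ^+ n)%:E * (\1_I s)%:E)).
  apply: eq_integral => s _; rewrite -(IH (\col_i l (lift ord0 i) 0)%R) muleC.
  rewrite -ge0_integralZl//; last first.
    by apply/measurable_EFinP/measurable_indic; exact: measurable_box_cV.
  apply: eq_integral => v _; rewrite -EFinM !indicE -natrM mulnb; congr (_%:R%:E).
  congr nat_of_bool; apply/idP/andP; rewrite !inE.
    move=> h; split; rewrite ?inE.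
      by have := h ord0; rewrite cons_cV0 /I/= in_itv/= => /andP[? ?]; apply/andP; split; lra.
    by move=> i; have := h (lift ord0 i); rewrite cons_cVS mxE.
  move=> [h1 h2] i; have [k ->|->] := unliftP ord0 i.
    by have := h2 k; rewrite cons_cVS mxE.
  by move: h1; rewrite cons_cV0 /I/= in_itv/= => /andP[? ?]; apply/andP; split; lra.
rewrite ge0_integralZl//; last 2 first.
- by apply/measurable_EFinP; apply: measurable_indic; exact: measurable_itv.
- by rewrite lee_fin exprn_ge0// ltW.
have leI : \int[lebesgue_measure]_s (\1_I s)%:E = c%:E.
  rewrite integral_indic//= ?setIT; last exact: measurable_itv.
  by rewrite /I lebesgue_measure_itv/= lte_fin ltrDr c0 -EFinB opprK subrK.
by apply: etrans (congr1 (fun x => _ * x) leI) _; rewrite -EFinM exprSr.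
Qed.

Variables (n : nat) (Gamma : 'M[R]_n) (Gamma_pos : posdefmx Gamma).
Variables (tau a : 'cV[R]_n).
Notation Q x := (bform (invmx Gamma) x x).
Notation sigma2 := (bform Gamma a a).
Notation "\int_ x f" := (\int[lebesgue_cV n]_x f) (at level 36, x name, f at level 36).

Definition shifted_orthant : set 'cV[R]_n := [set x | pos_cV (x + tau)%R].

Lemma measurable_shifted_orthant : measurable shifted_orthant.
Proof.
rewrite /shifted_orthant (_ : [set x | _] =
    [set x : 'cV[R]_n | forall i, [set y | 0 < y + tau i 0]%R (x i 0%R)]); last first.
  by apply/seteqP; split => x /= h i; have := h i; rewrite /= mxE.
apply: (@measurable_forall_coord n (fun i => [set y | 0 < y + tau i 0]%R)) => i.
rewrite (_ : [set _ | _] = [set` `](- tau i 0)%R, +oo[]) //.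
by apply/seteqP; split => y /=; rewrite in_itv/= andbT => ?; lra.
Qed.

(** Density of U up to a constant factor. *)
Definition orthant_weight (x : 'cV[R]_n) : R := (\1_shifted_orthant x * expR (- Q x / 2))%R.
Local Notation w := orthant_weight.
Local Notation C := shifted_orthant.

Lemma measurable_expR_bform (s : R) : measurable_fun setT (fun x : 'cV[R]_n => expR (- Q x / s)).
Proof.
apply: (measurableT_comp (measurable_expR (R := R))); apply: measurable_funM => //.
by apply: measurableT_comp => //; exact: measurable_bform.
Qed.

Lemma measurable_orthant_weight : measurable_fun setT w.
Proof.
apply: measurable_funM; last exact: measurable_expR_bform.
by apply: measurable_indic; exact: measurable_shifted_orthant.
Qed.

Lemma orthant_weight_ge0 x : (0 <= w x)%R.
Proof. by rewrite mulr_ge0 ?expR_ge0// indicE. Qed.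

(** The differences of pairs of points of the orthant with midpoint z; exchanging the two points
    shows its symmetry. *)
Let K (z : 'cV[R]_n) : set 'cV[R]_n :=
  [set u | C (z + 2^-1 *: u)%R /\ C (z - 2^-1 *: u)%R].

(** Parallelogram law, Q (z + u / 2) + Q (z - u / 2) = 2 Q z + Q u / 2: given the midpoint, the
    difference is N(0, 2 Gamma) restricted to K z. *)
Let orthant_weight_midpoint z u :
  (w (z + 2^-1 *: u) * w (z - 2^-1 *: u) = expR (- Q z) * (\1_(K z) u * expR (- Q u / 4)))%R.
Proof.
rewrite /w mulrACA -expRD [RHS]mulrCA -expRD !indicE -natrM mulnb.
have [iT _] := posdefmx_inv Gamma_pos.
congr (_ %:R * expR _)%R.
  by congr nat_of_bool; apply/andP/idP; rewrite !inE.
by rewrite !bformE (bformC u z iT); field.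
Qed.

Let measurable_K z : measurable (K z).
Proof.
have mline (s : R) : measurable_fun setT (fun u : 'cV[R]_n => z + s *: u)%R.
  by apply: measurable_addmx => //; exact: measurable_scalemx.
apply: measurableI; rewrite -[X in measurable X]setTI.
  exact: (mline 2^-1%R _ _ measurable_shifted_orthant).
have := mline (- 2^-1)%R measurableT _ measurable_shifted_orthant.
by congr measurable; apply/seteqP; split => u /= [_]; rewrite scaleNr.
Qed.

Let orthant_mid x y : C x -> C y -> C (2^-1 *: (x + y))%R.
Proof.
by move=> Cx Cy i; have := Cx i; have := Cy i; rewrite !mxE; lra.
Qed.

Let K_sym z u : K z u -> K z (- u)%R.
Proof. by rewrite /K/= scalerN opprK => -[]. Qed.

Let K_mid z x y : K z x -> K z y -> K z (2^-1 *: (x + y))%R.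
Proof.
move=> [x1 x2] [y1 y2]; split.
  have -> : (z + 2^-1 *: (2^-1 *: (x + y)) =
      2^-1 *: ((z + 2^-1 *: x) + (z + 2^-1 *: y)))%R.
    by apply/matrixP => i j; rewrite !mxE; field.
  exact: orthant_mid.
have -> : (z - 2^-1 *: (2^-1 *: (x + y)) =
    2^-1 *: ((z - 2^-1 *: x) + (z - 2^-1 *: y)))%R.
  by apply/matrixP => i j; rewrite !mxE; field.
exact: orthant_mid.
Qed.

Let k z u : R := (\1_(K z) u * expR (- Q u / 4))%R.

Let k_ge0 z u : (0 <= k z u)%R.
Proof. by rewrite mulr_ge0 ?expR_ge0// indicE. Qed.

Let measurable_k z : measurable_fun setT (k z).
Proof.
apply: measurable_funM; last exact: measurable_expR_bform.
exact: measurable_indic.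
Qed.

Implicit Type phi : 'cV[R]_n * 'cV[R]_n -> R.

(** The arguments of [phi] are the midpoint and the difference of the two points, so that [phi] may
    test one or the other. *)
Let two_point (phi : 'cV[R]_n * 'cV[R]_n -> R) (z : 'cV[R]_n * 'cV[R]_n) : \bar R :=
  (phi (2^-1 *: (z.1 + z.2), z.1 - z.2) * (w z.1 * w z.2))%:E.

Let measurable_two_point phi : measurable_fun setT phi -> measurable_fun setT (two_point phi).
Proof.
move=> mphi.
have mN : measurable_fun setT (fun z : 'cV[R]_n * 'cV[R]_n => - z.2)%R.
  by under eq_fun do rewrite -scaleN1r; exact: measurable_scalemx.
apply/measurable_EFinP; apply: measurable_funM.
  apply: (measurableT_comp mphi); apply: measurable_fun_pair.
    by apply: measurable_scalemx; apply: measurable_addmx.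
  by apply: measurable_addmx.
by apply: measurable_funM; apply: (measurableT_comp measurable_orthant_weight).
Qed.

Let two_point_ge0 phi z : (forall z, 0 <= phi z)%R -> 0 <= two_point phi z.
Proof. by move=> phi0; rewrite lee_fin !mulr_ge0// orthant_weight_ge0. Qed.

Let slice (phi : 'cV[R]_n * 'cV[R]_n -> R) (z : 'cV[R]_n) : \bar R :=
  (expR (- Q z))%:E * \int_u (phi (z, u) * k z u)%:E.

Let two_point_slice phi z : measurable_fun setT phi -> (forall z, 0 <= phi z)%R ->
  \int_u two_point phi (z + 2^-1 *: u, z - 2^-1 *: u)%R = slice phi z.
Proof.
move=> mphi phi0; rewrite /slice.
have mf : measurable_fun setT (fun u => (phi (z, u) * k z u)%:E).
  apply/measurable_EFinP; apply: measurable_funM => //.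
  by apply: (measurableT_comp mphi); exact: measurable_fun_pair.
have f0 u : setT u -> 0 <= (phi (z, u) * k z u)%:E by rewrite lee_fin mulr_ge0.
have e0 : 0 <= (expR (- Q z))%:E by rewrite lee_fin expR_ge0.
rewrite -(ge0_integralZl (lebesgue_cV n) measurableT mf f0 e0).
apply: eq_integral => u _; rewrite /two_point/= orthant_weight_midpoint -EFinM; congr (_%:E).
rewrite (_ : 2^-1 *: _ = z)%R; last by apply/matrixP => i j; rewrite !mxE; field.
rewrite (_ : _ - _ = u)%R; last by apply/matrixP => i j; rewrite !mxE; field.
by rewrite mulrCA.
Qed.

Let measurable_slice phi : measurable_fun setT phi -> (forall z, 0 <= phi z)%R ->
  measurable_fun setT (slice phi).
Proof.
move=> mphi phi0; apply: (eq_measurable_fun (fun z : 'cV[R]_n =>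
    \int_u two_point phi (z + 2^-1 *: u, z - 2^-1 *: u)%R)).
  by move=> z _; rewrite two_point_slice.
have mT : measurable_fun setT (fun z : 'cV[R]_n * 'cV[R]_n =>
    two_point phi (z.1 + 2^-1 *: z.2, z.1 - 2^-1 *: z.2)%R).
  apply: (measurableT_comp (measurable_two_point mphi)).
  apply: measurable_fun_pair; first by apply: measurable_addmx => //; exact: measurable_scalemx.
  under eq_fun do rewrite -scaleNr.
  by apply: measurable_addmx => //; exact: measurable_scalemx.
exact: (measurable_fun_fubini_tonelli_F (m2 := lebesgue_cV n) _ mT
  (fun=> two_point_ge0 _ phi0)).
Qed.

Let two_point_integral phi : measurable_fun setT phi -> (forall z, 0 <= phi z)%R ->
  \int_x \int_y two_point phi (x, y) = \int_z slice phi z.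
Proof.
move=> mphi phi0.
rewrite (ge0_integral_midpoint (measurable_two_point mphi) (fun=> two_point_ge0 _ phi0)).
by apply: eq_integral => z _; rewrite two_point_slice.
Qed.

(* If z lies within corner_width of the vertex of the orthant, the constraints
   defining K z force |a . u| <= sqrt sigma2: half of the bound on the variance
   of a . u given by gaussian_symmetric_variance. This is the source of
   strictness. *)
Let corner_width := (Num.sqrt sigma2 / (2 * (1 + \sum_i `|a i 0|)))%R.

Let corner_variance z u : (0 < sigma2)%R -> box_cV tau corner_width z -> K z u ->
  (dot a u ^+ 2 <= sigma2)%R.
Proof.
move=> s0 zB [Cp Cm].
have S0 : (0 <= \sum_i `|a i 0|)%R by apply: sumr_ge0.
(* The constraints at z + u / 2 and z - u / 2 give |u_i| / 2 < z_i + tau_i, which is less than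
   [corner_width] for z in the box. *)
have u_le i : (`|u i 0| <= 2 * corner_width)%R.
  have := Cp i; have := Cm i; have := zB i; rewrite !mxE => /andP[h1 h2] h3 h4.
  by rewrite ler_norml; apply/andP; split; lra.
have : (`|dot a u| <= Num.sqrt sigma2)%R.
  rewrite dotE; apply: le_trans (ler_norm_sum _ _ _) _.
  apply: (@le_trans _ _ (\sum_i `|a i 0| * (2 * corner_width))%R).
    by apply: ler_sum => i _; rewrite normrM ler_wpM2l.
  rewrite -mulr_suml /corner_width.
  rewrite (_ : _ * (2 * _) =
      Num.sqrt sigma2 * ((\sum_i `|a i 0|) / (1 + \sum_i `|a i 0|)))%R; last first.
    by field; rewrite gt_eqF// ltr_pwDl.
  by rewrite ler_piMr// ?sqrtr_ge0// ler_pdivrMr ?mul1r ?lerDr// ltr_pwDl.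
move=> h; rewrite -real_normK ?num_real// -[leRHS](sqr_sqrtr (ltW s0)).
by rewrite ler_sqr// nnegrE ?sqrtr_ge0.
Qed.

Let B := box_cV tau corner_width.

Let B_orthant z : B z -> C z.
Proof. by move=> zB i; have /andP[] := zB i; rewrite mxE. Qed.

Let corner_width_gt0 : (0 < sigma2)%R -> (0 < corner_width)%R.
Proof.
move=> s0; rewrite divr_gt0 ?sqrtr_gt0// mulr_gt0// ltr_pwDl// sumr_ge0//.
Qed.

Let B_mid x y : B x -> B y -> B (2^-1 *: (x + y))%R.
Proof.
move=> xB yB i; have /andP[x1 x2] := xB i; have /andP[y1 y2] := yB i.
by rewrite !mxE; apply/andP; split; lra.
Qed.

(** A zero integral would make the integrand vanish almost everywhere, whereas it is positive on the
    cube B, of positive volume. *)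
Let corner_mass_gt0 : (0 < sigma2)%R -> 0 < \int_x (\1_B x * w x)%:E.
Proof.
move=> s0; rewrite lt0e integral_ge0 ?andbT; last first.
  by move=> x _; rewrite lee_fin mulr_ge0// orthant_weight_ge0.
apply/eqP => i0.
have mBw : measurable_fun setT (fun x => (\1_B x * w x)%:E).
  apply/measurable_EFinP; apply: measurable_funM; last exact: measurable_orthant_weight.
  by apply: measurable_indic; exact: measurable_box_cV.
have : ae_eq (lebesgue_cV n) setT (fun x => (\1_B x * w x)%:E) (cst 0).
  apply/ae_eq_integral_abs => //; rewrite -i0; apply: eq_integral => x _.
  by rewrite gee0_abs// lee_fin mulr_ge0// orthant_weight_ge0.
move=> [N [mN N0 BN]].
have : lebesgue_cV n B <= lebesgue_cV n N.
  apply: le_measure; rewrite ?inE//; first exact: measurable_box_cV.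
  move=> x Bx; apply: BN => /= /(_ I); apply/eqP.
  rewrite eqe /w !indicE !mem_set//; last exact: B_orthant.
  by rewrite !mul1r gt_eqF// expR_gt0.
rewrite N0 lebesgue_box_cV ?corner_width_gt0// lee_fin leNgt.
by rewrite exprn_gt0// corner_width_gt0.
Qed.

(** Divided by the squared mass of [w], this says E (a.(U - U'))^2 < 2 sigma2. [JJ] integrates over
    z a bound that leaves sigma2 to spare on the corner B; [JB] makes the total gain positive. *)
Lemma orthant_variance_lt : (0 < sigma2)%R -> \int_x (w x)%:E < +oo ->
  \int_x \int_y ((dot a x - dot a y) ^+ 2 * (w x * w y))%:E <
  (2 * sigma2)%:E * ((\int_x (w x)%:E) * (\int_x (w x)%:E)).
Proof.
move=> s0 Zfin.
have mw := measurable_orthant_weight; have w0 := orthant_weight_ge0.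
have mwE : measurable_fun setT (fun x => (w x)%:E) by exact/measurable_EFinP.
pose phi2 (z : 'cV[R]_n * 'cV[R]_n) : R := (dot a z.2 ^+ 2)%R.
pose phiB (z : 'cV[R]_n * 'cV[R]_n) : R := \1_B z.1.
have mphi2 : measurable_fun setT phi2.
  by apply: measurable_funX; apply: (measurableT_comp (measurable_dot a)).
have mB1 : measurable_fun setT (\1_B : 'cV[R]_n -> R).
  by apply: measurable_indic; exact: measurable_box_cV.
have mphiB : measurable_fun setT phiB.
  exact: (measurableT_comp mB1 measurable_fst).
have prodE (f : 'cV[R]_n -> R) : measurable_fun setT f -> (forall x, 0 <= f x)%R ->
    \int_x \int_y (f x * f y)%:E = (\int_x (f x)%:E) * (\int_x (f x)%:E).
  move=> mf f0; rewrite -ge0_integralZr//; last 3 first.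
  - exact/measurable_EFinP.
  - by move=> x _; rewrite lee_fin.
  - by apply: integral_ge0 => x _; rewrite lee_fin.
  apply: eq_integral => x _; rewrite -ge0_integralZl//.
  - exact/measurable_EFinP.
  - by move=> y _; rewrite lee_fin.
  - by rewrite lee_fin.
have J2 : \int_x \int_y ((dot a x - dot a y) ^+ 2 * (w x * w y))%:E =
    \int_z slice phi2 z.
  rewrite -(two_point_integral mphi2 (fun=> sqr_ge0 _)).
  apply: eq_integral => x _; apply: eq_integral => y _.
  by rewrite /two_point/phi2/= dotD dotN.
have J1 : (\int_x (w x)%:E) * (\int_x (w x)%:E) = \int_z slice (cst 1%R) z.
  rewrite -prodE// -(two_point_integral (phi := cst 1%R) (measurable_cst _) (fun=> ler01)).
  by apply: eq_integral => x _; apply: eq_integral => y _; rewrite /two_point mul1r.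
have mBw : measurable_fun setT (fun x => \1_B x * w x)%R by apply: measurable_funM.
(* B is midpoint convex, so the pairs with midpoint in B include B x B, whose mass is the square of
   a positive number. *)
have JB : 0 < \int_z slice phiB z.
  have phiB0 z : (0 <= phiB z)%R by rewrite /phiB indicE.
  rewrite -(two_point_integral mphiB phiB0).
  apply: (@lt_le_trans _ _ ((\int_x (\1_B x * w x)%:E) * (\int_x (\1_B x * w x)%:E))).
    by apply: mule_gt0; exact: corner_mass_gt0.
  have Bw0 x : (0 <= \1_B x * w x)%R by rewrite mulr_ge0.
  rewrite -(prodE _ mBw Bw0).
  have mpair (x : 'cV[R]_n) : measurable_fun setT (fun y : 'cV[R]_n => (x, y)).
    exact: measurable_fun_pair.
  pose G (z : 'cV[R]_n * 'cV[R]_n) := ((\1_B z.1 * w z.1) * (\1_B z.2 * w z.2))%:E.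
  have mG : measurable_fun setT G.
    apply/measurable_EFinP.
    exact: (measurable_funM (measurableT_comp mBw measurable_fst)
      (measurableT_comp mBw measurable_snd)).
  have G0 z : 0 <= G z by rewrite lee_fin (mulr_ge0 (Bw0 _) (Bw0 _)).
  have tp0 z : 0 <= two_point phiB z by exact: (two_point_ge0 _ phiB0).
  have mtp := measurable_two_point mphiB.
  apply: ge0_le_integral => //.
  - by move=> x _; apply: integral_ge0 => y _; exact: (G0 (x, y)).
  - exact: (measurable_fun_fubini_tonelli_F (m2 := lebesgue_cV n) _ mG G0).
  - exact: (measurable_fun_fubini_tonelli_F (m2 := lebesgue_cV n) _ mtp tp0).
  move=> x _; apply: ge0_le_integral => //.
  - by move=> y _; exact: (G0 (x, y)).
  - exact: (measurableT_comp mG (mpair x)).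
  - exact: (measurableT_comp mtp (mpair x)).
  move=> y _; rewrite /two_point /phiB lee_fin/= mulrACA ler_wpM2r//.
    by rewrite mulr_ge0.
  rewrite !indicE -natrM ler_nat mulnb.
  have [/andP[]|//] := boolP ((x \in B) && (y \in B)).
  by rewrite !inE => Bx By; rewrite mem_set//; exact: B_mid.
have phi20 z : (0 <= phi2 z)%R by exact: sqr_ge0.
have sl0 (phi : 'cV[R]_n * 'cV[R]_n -> R) z : (forall z, 0 <= phi z)%R -> 0 <= slice phi z.
  move=> phi0; rewrite mule_ge0 ?lee_fin ?expR_ge0// integral_ge0// => u _.
  by rewrite lee_fin mulr_ge0.
have JJ : \int_z slice phi2 z + sigma2%:E * \int_z slice phiB z <=
    (2 * sigma2)%:E * \int_z slice (cst 1%R) z.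
  have s0E : 0 <= sigma2%:E by rewrite lee_fin ltW.
  have s20E : 0 <= (2 * sigma2)%:E by rewrite lee_fin mulr_ge0// ltW.
  have phiB0 z : (0 <= phiB z)%R by rewrite /phiB indicE.
  have mB' := measurable_slice mphiB phiB0.
  have m2' := measurable_slice mphi2 phi20.
  have m1' := measurable_slice (phi := cst 1%R) (measurable_cst _) (fun=> ler01).
  have sB0 z : setT z -> 0 <= slice phiB z by move=> _; exact: sl0.
  have s10 z : setT z -> 0 <= slice (cst 1%R) z by move=> _; exact: (sl0 _ _ (fun=> ler01)).
  have s20' z : setT z -> 0 <= slice phi2 z by move=> _; exact: sl0.
  have sB0' z : setT z -> 0 <= sigma2%:E * slice phiB z.
    by move=> _; apply: mule_ge0 => //; exact: sB0.
  rewrite -(ge0_integralZl (lebesgue_cV n) measurableT mB' sB0 s0E).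
  rewrite -(ge0_integralZl (lebesgue_cV n) measurableT m1' s10 s20E).
  have msB := measurable_funeM sigma2%:E mB'.
  rewrite -(ge0_integralD (lebesgue_cV n) measurableT s20' m2' sB0' msB).
  apply: ge0_le_integral => //.
  - by move=> z _; apply: adde_ge0; [exact: s20'|exact: sB0'].
  - exact: emeasurable_funD.
  - exact: measurable_funeM.
  move=> z _; rewrite /slice muleCA [leRHS]muleCA.
  have M0 phi : (forall z, 0 <= phi z)%R -> 0 <= \int_u (phi (z, u) * k z u)%:E.
    by move=> phi0; apply: integral_ge0 => u _; rewrite lee_fin mulr_ge0.
  rewrite -ge0_muleDr; [|exact: M0|by apply: mule_ge0 => //; exact: M0].
  apply: lee_pmul => //.
    by apply: adde_ge0; [exact: M0|by apply: mule_ge0 => //; exact: M0].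
  have -> : \int_u (cst 1%R (z, u) * k z u)%:E = \int_u (k z u)%:E.
    by apply: eq_integral => u _; rewrite mul1r.
  (* Off the corner the symmetric bound 2 sigma2 is used as it is. On it [corner_variance] bounds
     the integrand by sigma2 times the weight, and the sigma2 saved pays for the [phiB] term. *)
  have [zB|zB] := pselect (B z); last first.
    rewrite (_ : \int_u (phiB _ * _)%:E = 0) ?mule0 ?adde0; last first.
      by apply: integral0_eq => u _; rewrite /phiB indicE memNset// mul0r.
    exact: (gaussian_symmetric_variance Gamma_pos (measurable_K z) (@K_sym z) (@K_mid z) s0).
  have -> : \int_u (phiB (z, u) * k z u)%:E = \int_u (k z u)%:E.
    by apply: eq_integral => u _; rewrite /phiB indicE mem_set// mul1r.
  rewrite (_ : 2 * sigma2 = sigma2 + sigma2)%R; last by ring.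
  have k0 : 0 <= \int_u (k z u)%:E by rewrite integral_ge0// => u _; rewrite lee_fin.
  rewrite EFinD ge0_muleDl//.
  apply: leeD => //.
  have mkz : measurable_fun setT (fun u => (k z u)%:E) by exact/measurable_EFinP.
  have kz0 u : setT u -> 0 <= (k z u)%:E by rewrite lee_fin.
  rewrite -(ge0_integralZl (lebesgue_cV n) measurableT mkz kz0 s0E).
  apply: ge0_le_integral => //.
  - by move=> u _; rewrite lee_fin mulr_ge0.
  - apply/measurable_EFinP; apply: measurable_funM => //.
    by apply: measurable_funX; exact: measurable_dot.
  - by apply: measurable_funeM; exact/measurable_EFinP.
  move=> u _; rewrite -EFinM lee_fin.
  have [uK|uK] := pselect (K z u); last by rewrite /k indicE memNset// mul0r !mulr0.
  by rewrite ler_wpM2r//; exact: corner_variance.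
rewrite J2 J1.
(* A positive gain gives a strict inequality only if the integral of [slice phi2] is finite; [JJ]
   bounds it by this finite quantity. *)
have Jfin : (2 * sigma2)%:E * \int_z slice (cst 1%R) z < +oo.
  rewrite -J1 lte_mul_pinfty ?lee_fin ?mulr_ge0 ?(ltW s0)//.
  rewrite lte_mul_pinfty//; first by rewrite integral_ge0// => x _; rewrite lee_fin.
  by rewrite ge0_fin_numE// integral_ge0// => x _; rewrite lee_fin.
apply: (lt_le_trans _ JJ); rewrite lteDl//.
  by rewrite mule_gt0.
rewrite ge0_fin_numE; last by apply: integral_ge0 => z _; exact: sl0.
apply: le_lt_trans Jfin; apply: le_trans JJ.
by rewrite leeDl// mule_ge0 ?ltW// ltW.
Qed.

End orthant_variance.

(** * Moments of Gaussian vectors *)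

Section density.
Set Implicit Arguments.
Unset Strict Implicit.
Import HBNNSimple.
Local Open Scope ereal_scope.

Lemma nnsfun_integral_density d (T : measurableType d) (R : realType)
    (mu nu : {measure set T -> \bar R}) (p : T -> R) (h : {nnsfun T >-> R}) :
  measurable_fun setT p -> (forall x, 0 <= p x)%R ->
  (forall A, measurable A -> nu A = \int[mu]_(x in A) (p x)%:E) ->
  \int[nu]_x (h x)%:E = \int[mu]_x (h x * p x)%:E.
Proof.
move=> mp p0 nuE.
have mpre r : measurable (h @^-1` [set r]) by [].
transitivity (\sum_(r \in range h) r%:E * nu (h @^-1` [set r])).
  under eq_integral do rewrite fimfunE -fsumEFin//.
  rewrite ge0_integral_fsum//; last 2 first.
  - by move=> y; exact/measurable_EFinP/measurable_funM.
  - by move=> y x _; rewrite nnfun_muleindic_ge0.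
  apply: eq_fsbigr => r _; rewrite integralZl_indic_nnsfun// integral_indic//=.
  by rewrite setIT.
transitivity (\sum_(r \in range h) \int[mu]_x (r * \1_(h @^-1` [set r]) x * p x)%:E); last first.
  rewrite -ge0_integral_fsum//; last 2 first.
  - move=> r; apply/measurable_EFinP; apply: measurable_funM => //.
    exact: measurable_funM.
  - move=> r x _; have := nnfun_muleindic_ge0 h r x.
    by rewrite -EFinM !lee_fin => /mulr_ge0; apply.
  apply: eq_integral => x _; rewrite fsumEFin// fimfunE.
  by rewrite mulr_fsuml.
apply: eq_fsbigr => r; rewrite inE => -[x _ <-].
rewrite nuE// [in LHS]integral_mkcond -ge0_integralZl//.
- apply: eq_integral => y _; rewrite -mulrA EFinM; congr (_ * _).
  rewrite patchE indicE /=; case: ifPn => yh; first by rewrite mul1r.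
  by rewrite mul0r.
- by apply/(measurable_restrictT _ _).1 => //; exact/measurable_EFinP/measurable_funTS.
- by move=> y _; apply: erestrict_ge0 => z _; rewrite lee_fin.
- by rewrite lee_fin.
Qed.

Lemma ge0_integral_density d (T : measurableType d) (R : realType)
    (mu nu : {measure set T -> \bar R}) (p : T -> R) (g : T -> \bar R) :
  measurable_fun setT p -> (forall x, 0 <= p x)%R ->
  (forall A, measurable A -> nu A = \int[mu]_(x in A) (p x)%:E) ->
  measurable_fun setT g -> (forall x, 0 <= g x) ->
  \int[nu]_x g x = \int[mu]_x (g x * (p x)%:E).
Proof.
move=> mp p0 nuE mg g0.
pose g_ := nnsfun_approx measurableT mg.
transitivity (limn (fun n => \int[nu]_x (g_ n x)%:E)).
  rewrite -monotone_convergence//.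
  - apply: eq_integral => y yD; apply/esym/cvg_lim => //.
    exact: cvg_nnsfun_approx.
  - by move=> n; exact/measurable_EFinP/measurable_funP.
  - by move=> n y _; rewrite lee_fin.
  - by move=> y _ m n mn; rewrite lee_fin; exact/lefP/nd_nnsfun_approx.
under eq_fun do rewrite (nnsfun_integral_density _ mp p0 nuE).
rewrite -monotone_convergence//.
- apply: eq_integral => y _; apply/cvg_lim => //.
  under eq_fun do rewrite EFinM.
  by apply: cvgeZr => //; exact: cvg_nnsfun_approx.
- by move=> n; apply/measurable_EFinP; apply: measurable_funM.
- by move=> n y _; rewrite lee_fin mulr_ge0.
- move=> y _ m n mn; rewrite lee_fin ler_wpM2r//.
  exact/lefP/nd_nnsfun_approx.
Qed.

End density.

(** * Random variables with finite moments of every order *)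

Section all_moments.
Set Implicit Arguments.
Unset Strict Implicit.
Context {disp : measure_display} {T : measurableType disp} {R : realType}.
Variable P : probability T R.
Implicit Types f g : T -> R.

(** Unlike integrability, this property is stable under products, so every polynomial in the
    coordinates is integrable without any count of degrees. *)
Definition all_moments f :=
  measurable_fun setT f /\ forall n, P.-integrable setT (fun t => (f t ^+ n)%:E).

Lemma all_moments_integrable f : all_moments f -> P.-integrable setT (EFin \o f).
Proof.
move=> [_ /(_ 1%N)]; by apply: eq_integrable => // t _; rewrite expr1.
Qed.

Lemma le_integrableR f g : measurable_fun setT f -> (forall t, `|f t| <= g t) ->
  P.-integrable setT (EFin \o g) -> P.-integrable setT (EFin \o f).
Proof.
move=> mf fg; apply: le_integrable => //; first exact/measurable_EFinP.
by move=> t _ /=; rewrite lee_fin (le_trans (fg t))// ler_norm.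
Qed.

Lemma all_moments_cst c : all_moments (cst c).
Proof.
by split=> // n; exact: (finite_measure_integrable_cst P (c ^+ n) measurableT).
Qed.

Lemma all_moments_norm f n : all_moments f ->
  P.-integrable setT (EFin \o (fun t => `|f t| ^+ n)).
Proof.
move=> [_ /(_ n)] /integrable_abse; apply: eq_integrable => // t _ /=.
by rewrite normrX.
Qed.

Lemma integrableRD f g : P.-integrable setT (EFin \o f) -> P.-integrable setT (EFin \o g) ->
  P.-integrable setT (EFin \o (fun t => f t + g t)).
Proof. by move=> fi gi; apply: eq_integrable (integrableD _ fi gi). Qed.

Lemma integrableRZ c f : P.-integrable setT (EFin \o f) ->
  P.-integrable setT (EFin \o (fun t => c * f t)).
Proof. by move=> fi; apply: eq_integrable (integrableZl _ c fi). Qed.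

(** |f g|^n <= |f|^(2n) + |g|^(2n): order n of a product uses order 2n of its factors, which is why
    all orders are required at once. *)
Lemma all_momentsM f g : all_moments f -> all_moments g ->
  all_moments (fun t => f t * g t).
Proof.
move=> hf hg; have [mf _] := hf; have [mg _] := hg.
have mfg : measurable_fun setT (fun t => f t * g t) by exact: measurable_funM.
split=> // n.
apply: (@le_integrableR _ (fun t => `|f t| ^+ (n + n) + `|g t| ^+ (n + n))).
- exact: measurable_funX.
- move=> t; rewrite exprMn normrM !normrX !exprD.
  have := sqr_ge0 (`|f t| ^+ n - `|g t| ^+ n).
  have := exprn_ge0 n (normr_ge0 (f t)); have := exprn_ge0 n (normr_ge0 (g t)).
  nra.
- by apply: integrableRD; exact: all_moments_norm.
Qed.

Lemma all_momentsD f g : all_moments f -> all_moments g ->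
  all_moments (fun t => f t + g t).
Proof.
move=> hf hg; have [mf _] := hf; have [mg _] := hg.
have mfg : measurable_fun setT (fun t => f t + g t) by exact: measurable_funD.
split=> // n.
apply: (@le_integrableR _ (fun t => 2 ^+ n * (`|f t| ^+ n + `|g t| ^+ n))).
- exact: measurable_funX.
- move=> t; rewrite normrX.
  apply: (@le_trans _ _ ((2 * Num.max `|f t| `|g t|) ^+ n)).
    rewrite lerXn2r ?nnegrE ?mulr_ge0 ?le_max ?normr_ge0//.
    apply: le_trans (ler_normD _ _) _; rewrite mulrC mulr_natr mulr2n.
    by apply: lerD; rewrite le_max lexx ?orbT.
  rewrite exprMn ler_wpM2l//; have [_|_] := leP `|f t| `|g t|.
    by rewrite lerDr exprn_ge0.
  by rewrite lerDl exprn_ge0.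
- by apply: integrableRZ; apply: integrableRD; exact: all_moments_norm.
Qed.

Lemma all_momentsZ c f : all_moments f -> all_moments (fun t => c * f t).
Proof. by apply: all_momentsM; exact: all_moments_cst. Qed.

Lemma all_moments_sum (I : Type) (s : seq I) (f : I -> T -> R) :
  (forall i, all_moments (f i)) -> all_moments (fun t => \sum_(i <- s) f i t).
Proof.
move=> hf; elim: s => [|i s IH].
  by under eq_fun do rewrite big_nil; exact: all_moments_cst.
by under eq_fun do rewrite big_cons; exact: all_momentsD.
Qed.

Lemma all_moments_norm_fun f : all_moments f -> all_moments (fun t => `|f t|).
Proof.
move=> hf; have [mf _] := hf; split => [|n]; first exact: measurableT_comp.
exact: all_moments_norm.
Qed.

(** |x|^n / n! is a term of the series of exp |x|, and exp |x| <= exp x + exp (- x). *)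
Lemma normr_expR_bound (x : R) n : `|x| ^+ n <= n`!%:R * (expR x + expR (- x)).
Proof.
have nx : 1 + `|x| ^+ n / n`!%:R <= 1 + (expR x + expR (- x)).
  case: n => [|n].
    rewrite expr0 fact0 divr1 lerD2l; have := expR_addN_ge x.
    have := sqr_ge0 x; lra.
  apply: le_trans (expR_ge1Dxn n (normr_ge0 x)) _.
  have := expR_ge0 x; have := expR_ge0 (- x).
  by case: (ger0P x) => _; lra.
by rewrite lerD2l ler_pdivrMr ?ltr0n ?fact_gt0// in nx; rewrite mulrC.
Qed.

Definition exp_integrable f :=
  forall s : R, P.-integrable setT (fun t => (expR (s * f t))%:E).

Lemma all_moments_exp_integrable f : measurable_fun setT f -> exp_integrable f ->
  all_moments f.
Proof.
move=> mf ef; split => // n.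
apply: (@le_integrableR _ (fun t => n`!%:R * (expR (1 * f t) + expR (- 1 * f t)))).
- exact: measurable_funX.
- by move=> t; rewrite normrX mul1r mulN1r; exact: normr_expR_bound.
- by apply: integrableRZ; apply: integrableRD; exact: ef.
Qed.

Lemma all_moments_expR f s : measurable_fun setT f -> exp_integrable f ->
  all_moments (fun t => expR (s * f t)).
Proof.
move=> mf ef; split=> [|n].
  apply: (measurableT_comp (measurable_expR (R := R))).
  exact: measurable_funM.
apply: eq_integrable (ef (n%:R * s)) => // t _.
by rewrite -mulrA expRM_natl.
Qed.

End all_moments.

(** * Exponential moments of Gaussian and truncated Gaussian vectors *)

Section gaussian_law.
Set Implicit Arguments.
Unset Strict Implicit.
Context {disp : measure_display} {T : measurableType disp} {R : realType}.
Variable P : probability T R.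
Local Open Scope ereal_scope.

Lemma ge0_expectation_density n (X : {RV P >-> 'cV[R]_n}) (p : 'cV[R]_n -> R)
    (g : 'cV[R]_n -> \bar R) :
  measurable_fun setT p -> (forall x, 0 <= p x)%R ->
  has_law X (fun A => \int[lebesgue_cV n]_(x in A) (p x)%:E) ->
  measurable_fun setT g -> (forall x, 0 <= g x) ->
  \int[P]_t g (X t) = \int[lebesgue_cV n]_x (g x * (p x)%:E).
Proof.
move=> mp p0 Xp mg g0.
rewrite -(ge0_integral_density mp p0 Xp mg g0).
by rewrite /distribution ge0_integral_pushforward.
Qed.

Variables (n : nat) (Gamma : 'M[R]_n) (Gamma_pos : posdefmx Gamma).
Notation Q x := (bform (invmx Gamma) x x).

Definition gaussian_exp (x : 'cV[R]_n) : R := expR (- Q x / 2).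

Lemma measurable_gaussian_exp : measurable_fun setT gaussian_exp.
Proof. exact: measurable_expR_bform. Qed.

Lemma gaussian_exp_shift (a x : 'cV[R]_n) :
  gaussian_exp (x - Gamma *m a) =
  (gaussian_exp x * expR (dot a x - bform Gamma a a / 2))%R.
Proof.
have := bform_inv_shift a x 1 Gamma_pos; rewrite scale1r => h.
by rewrite /gaussian_exp h -expRD; congr expR; field.
Qed.

Section restricted.
Variables (X : {RV P >-> 'cV[R]_n}) (C : set 'cV[R]_n) (c : R).
Hypothesis mC : measurable C.
Hypothesis c0 : (0 <= c)%R.
Hypothesis X_law : has_law X
  (fun A => \int[lebesgue_cV n]_(x in A) (c * (\1_C x * gaussian_exp x))%:E).
Hypothesis total_fin : \int[lebesgue_cV n]_x (gaussian_exp x)%:E < +oo.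

Let measurable_density : measurable_fun setT (fun x => c * (\1_C x * gaussian_exp x))%R.
Proof.
apply: measurable_funM => //; apply: measurable_funM; first exact: measurable_indic.
exact: measurable_gaussian_exp.
Qed.

Let density_ge0 x : (0 <= c * (\1_C x * gaussian_exp x))%R.
Proof. by rewrite mulr_ge0// mulr_ge0// ?expR_ge0// indicE. Qed.

(** The exponential of a linear form times the Gaussian weight is a translate of that weight, up to
    a constant; bounding the indicator of C by 1 leaves the total mass. C is the whole space for a
    Gaussian vector and the shifted orthant for U. *)
Lemma exp_integrable_dot (a : 'cV[R]_n) : exp_integrable P (fun t => dot a (X t)).
Proof.
move=> s; have mX : measurable_fun setT X by [].
have mdX : measurable_fun setT (fun x : 'cV[R]_n => expR (s * dot a x)).
  apply: (measurableT_comp (measurable_expR (R := R))); apply: measurable_funM => //.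
  exact: measurable_dot.
apply/integrableP; split.
  by apply/measurable_EFinP; exact: (measurableT_comp mdX mX).
under eq_integral do rewrite gee0_abs ?lee_fin ?expR_ge0//.
have mE : measurable_fun setT (fun x => (expR (s * dot a x))%:E) by exact/measurable_EFinP.
rewrite (ge0_expectation_density measurable_density density_ge0 X_law mE); last first.
  by move=> x; rewrite lee_fin expR_ge0.
pose K := (c * expR (bform Gamma (s *: a) (s *: a) / 2))%R.
have K0 : (0 <= K)%R by rewrite mulr_ge0// expR_ge0.
apply: (@le_lt_trans _ _
  (\int[lebesgue_cV n]_x (K%:E * (gaussian_exp (x - Gamma *m (s *: a)))%:E))).
  have mg : measurable_fun setT (fun x : 'cV[R]_n => gaussian_exp (x - Gamma *m (s *: a))%R).
    by apply: (measurableT_comp measurable_gaussian_exp); exact: measurable_addmx.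
  apply: ge0_le_integral => //.
  - by move=> x _; rewrite -EFinM lee_fin mulr_ge0// expR_ge0.
  - by apply: emeasurable_funM => //; exact/measurable_EFinP.
  - by apply: measurable_funeM; exact/measurable_EFinP.
  move=> x _; rewrite -!EFinM lee_fin gaussian_exp_shift /K dotZl.
  set b := (bform _ _ _ / 2)%R.
  have -> : expR (s * dot a x) = (expR b * expR (s * dot a x - b))%R.
    by rewrite -expRD; congr expR; ring.
  have := expR_ge0 b; have := expR_ge0 (s * dot a x - b); have := expR_ge0 (- Q x / 2).
  rewrite -/(gaussian_exp x) indicE.
  move: (expR b) (expR (_ - _)) (gaussian_exp x) => e1 e2 e3 e30 e20 e10.
  have h0 : (0 <= e1 * e2 * (c * e3))%R by rewrite !mulr_ge0.
  by case: (_ \in _) => /=; lra.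
have mgE : measurable_fun setT (fun x : 'cV[R]_n => (gaussian_exp (x - Gamma *m (s *: a)))%:E).
  apply/measurable_EFinP; apply: (measurableT_comp measurable_gaussian_exp).
  exact: measurable_addmx.
have gE0 (x : 'cV[R]_n) : setT x -> 0 <= (gaussian_exp (x - Gamma *m (s *: a)))%:E.
  by rewrite lee_fin expR_ge0.
rewrite (ge0_integralZl (lebesgue_cV n) measurableT mgE gE0)//.
have mg2 : measurable_fun setT (fun x : 'cV[R]_n => (gaussian_exp x)%:E).
  by apply/measurable_EFinP; exact: measurable_gaussian_exp.
rewrite -(ge0_integral_translate_cV _ mg2); last by move=> x; rewrite lee_fin expR_ge0.
by rewrite lte_mul_pinfty// integral_ge0// => x _; rewrite lee_fin expR_ge0.
Qed.

End restricted.
End gaussian_law.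

(** * The Cameron-Martin formula and Stein's identity *)

Section gaussian_stein.
Set Implicit Arguments.
Unset Strict Implicit.
Context {disp : measure_display} {T : measurableType disp} {R : realType}.
Variable P : probability T R.
Variables (n : nat) (Gamma : 'M[R]_n) (Gamma_pos : posdefmx Gamma).
Variable X : {RV P >-> 'cV[R]_n}.
Hypothesis X_law : has_law X (mvnormal_prob 0 Gamma).
Notation G := (gaussian_exp Gamma).
Let c : R := (Num.sqrt ((2 * pi) ^+ n * \det Gamma))^-1.

Lemma mvnormal_pdf0E x : mvnormal_pdf 0 Gamma x = c * G x.
Proof. by rewrite /mvnormal_pdf subr0. Qed.

Let mG : measurable_fun setT G.
Proof. exact: measurable_gaussian_exp. Qed.

Let c_ge0 : 0 <= c.
Proof. by rewrite invr_ge0 sqrtr_ge0. Qed.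

Let G_ge0 x : 0 <= G x.
Proof. exact: expR_ge0. Qed.

Let mcG : measurable_fun setT (fun x => c * G x).
Proof. exact: measurable_funM. Qed.

Let cG_ge0 x : 0 <= c * G x.
Proof. exact: mulr_ge0. Qed.

Lemma mvnormal_law_gaussian_exp :
  has_law X (fun A => \int[lebesgue_cV n]_(x in A) (c * G x)%:E)%E.
Proof.
move=> A mA; rewrite (X_law mA); apply: eq_integral => x _.
by rewrite mvnormal_pdf0E.
Qed.

Lemma mvnormal_total : (c%:E * \int[lebesgue_cV n]_x (G x)%:E = 1)%E.
Proof.
have := mvnormal_law_gaussian_exp measurableT; rewrite probability_setT => ->.
rewrite -ge0_integralZl//; first exact/measurable_EFinP.
by move=> x _; rewrite lee_fin.
Qed.

(** The law of X has total mass 1, whereas c times an infinite integral would be 0 or +oo. *)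
Lemma mvnormal_total_fin : (\int[lebesgue_cV n]_x (G x)%:E < +oo)%E.
Proof.
have := mvnormal_total; have : (0 <= \int[lebesgue_cV n]_x (G x)%:E)%E.
  by apply: integral_ge0 => x _; rewrite lee_fin.
move: (\int[_]_x _)%E => [r| |]//; rewrite ?ltry// => _.
have [->|c0] := eqVneq c 0; first by rewrite mul0e => /eqP; rewrite eqe eq_sym oner_eq0.
by rewrite gt0_muley// lte_fin lt_neqAle eq_sym c0 c_ge0.
Qed.

Lemma mvnormal_exp_integrable (a : 'cV[R]_n) : exp_integrable P (fun t => dot a (X t)).
Proof.
apply: (exp_integrable_dot Gamma_pos measurableT c_ge0 _ mvnormal_total_fin).
move=> A mA; rewrite mvnormal_law_gaussian_exp//; apply: eq_integral => x _.
by rewrite indicT mul1r.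
Qed.

Lemma ge0_cameron_martin (a : 'cV[R]_n) (g : 'cV[R]_n -> \bar R) :
  measurable_fun setT g -> (forall x, 0 <= g x)%E ->
  (\int[P]_t g (X t + Gamma *m a)%R =
   \int[P]_t (g (X t) * (expR (dot a (X t) - bform Gamma a a / 2))%:E))%E.
Proof.
move=> mg g0.
have mgs : measurable_fun setT (fun x : 'cV[R]_n => g (x + Gamma *m a)).
  by apply: (measurableT_comp mg); exact: measurable_addmx.
have me : measurable_fun setT (fun x : 'cV[R]_n => expR (dot a x - bform Gamma a a / 2)).
  apply: (measurableT_comp (measurable_expR (R := R))); apply: measurable_funB => //.
  exact: measurable_dot.
have mge : measurable_fun setT
    (fun x : 'cV[R]_n => g x * (expR (dot a x - bform Gamma a a / 2))%:E)%E.
  by apply: emeasurable_funM => //; exact/measurable_EFinP.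
rewrite (ge0_expectation_density mcG cG_ge0 mvnormal_law_gaussian_exp mgs)//.
rewrite (ge0_expectation_density mcG cG_ge0 mvnormal_law_gaussian_exp mge); last first.
  by move=> x; rewrite mule_ge0// lee_fin expR_ge0.
have mh : measurable_fun setT (fun x : 'cV[R]_n => g (x + Gamma *m a)%R * (c * G x)%:E)%E.
  by apply: emeasurable_funM => //; exact/measurable_EFinP.
have h0 x : (0 <= g (x + Gamma *m a)%R * (c * G x)%:E)%E.
  by rewrite mule_ge0// lee_fin.
rewrite (ge0_integral_translate_cV (- (Gamma *m a)) mh h0).
apply: eq_integral => x _; rewrite subrK -muleA -EFinM; congr (_ * _%:E)%E.
by rewrite gaussian_exp_shift//; ring.
Qed.

(** Integrability is not at stake: positive and negative parts are transformed separately, so both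
    sides agree as extended reals before [fine] is applied. *)
Lemma cameron_martin (a : 'cV[R]_n) (f : 'cV[R]_n -> R) : measurable_fun setT f ->
  \int[P]_t f (X t + Gamma *m a) =
  \int[P]_t (f (X t) * expR (dot a (X t) - bform Gamma a a / 2)).
Proof.
move=> mf; have mfE : measurable_fun setT (EFin \o f) by exact/measurable_EFinP.
congr fine; rewrite [LHS]integralE [RHS]integralE; congr (_ - _)%E.
- transitivity (\int[P]_t ((EFin \o f)^\+ (X t + Gamma *m a)%R))%E.
    by apply: eq_integral => t _; rewrite !funeposE.
  rewrite (ge0_cameron_martin a (measurable_funepos mfE))//.
  apply: eq_integral => t _; rewrite !funeposE /= maxe_pMl ?lee_fin ?expR_ge0//.
  by rewrite mul0e.
- transitivity (\int[P]_t ((EFin \o f)^\- (X t + Gamma *m a)%R))%E.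
    by apply: eq_integral => t _; rewrite !funenegE.
  rewrite (ge0_cameron_martin a (measurable_funeneg mfE))//.
  apply: eq_integral => t _; rewrite !funenegE /= maxe_pMl ?lee_fin ?expR_ge0//.
  by rewrite mul0e -EFinM mulNr.
Qed.

(** From exp x - 1 <= x exp x, the remainder is at most x (exp x - 1), where a second first-order
    bound supplies the other factor x. *)
Lemma expR_taylor1 (x : R) : `|expR x - 1 - x| <= x ^+ 2 * expR `|x|.
Proof.
have h1 := expR_ge1Dx x; have h2 := expR_ge1Dx (- x).
have e0 := expR_gt0 x.
have h3 : expR x - 1 <= x * expR x.
  rewrite expRN in h2; have := ler_wpM2l (ltW e0) h2; rewrite divff ?gt_eqF//; lra.
rewrite ger0_norm; last by lra.
have [x0|x0] := ger0P x; first by nra.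
have : 1 <= expR (- x) by rewrite -expR0 ler_expR oppr_ge0 ltW.
nra.
Qed.

(* Both sides of cameron_martin along s *: a are expanded at s = 0: the left one is
   a polynomial in s, the right one has a remainder of order s ^+ 2. *)
Lemma stein_identity (a : 'cV[R]_n) (f0 f1 f2 f3 : 'cV[R]_n -> R) :
  measurable_fun setT f0 ->
  all_moments P (f0 \o X) -> all_moments P (f1 \o X) ->
  all_moments P (f2 \o X) -> all_moments P (f3 \o X) ->
  (forall v s, f0 (v + s *: (Gamma *m a)) =
     f0 v + s * f1 v + s ^+ 2 * f2 v + s ^+ 3 * f3 v) ->
  \int[P]_t (dot a (X t) * f0 (X t)) = \int[P]_t f1 (X t).
Proof.
move=> mf0 M0 M1 M2 M3 fE.
have I f := @all_moments_integrable _ _ _ P f.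
pose Y t := dot a (X t).
have mY : measurable_fun setT Y.
  by apply: (measurableT_comp (measurable_dot a)).
have MY : all_moments P Y.
  by apply: all_moments_exp_integrable => //; exact: mvnormal_exp_integrable.
have Mexp s : all_moments P (fun t => expR (s * Y t)).
  by apply: all_moments_expR => //; exact: mvnormal_exp_integrable.
pose A := \int[P]_t f0 (X t); pose B := \int[P]_t f1 (X t).
pose B' := \int[P]_t (Y t * f0 (X t)).
pose C := \int[P]_t f2 (X t); pose D := \int[P]_t f3 (X t).
pose beta := bform Gamma a a.
have beta0 : 0 <= beta by have [_ +] := posdefmx_semidef Gamma_pos; apply.
(* s ^+ 2 * w dominates the remainder of the expansion of f0 (X) exp (s Y) for 0 <= s <= 1, since
   exp |Y| <= exp Y + exp (- Y). *)
pose w t := `|f0 (X t)| * (Y t ^+ 2 * (expR (1 * Y t) + expR (- 1 * Y t))).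
have Mw : all_moments P w.
  apply: all_momentsM; first exact: all_moments_norm_fun.
  apply: all_momentsM; last exact: all_momentsD.
  by under eq_fun do rewrite expr2; exact: all_momentsM.
pose K := \int[P]_t w t.
have K0 : 0 <= K.
  apply: Rintegral_ge0 => t _; apply: mulr_ge0 => //; apply: mulr_ge0; first exact: sqr_ge0.
  by rewrite addr_ge0// expR_ge0.
have shift s : A + s * B + s ^+ 2 * C + s ^+ 3 * D =
    expR (- (s ^+ 2 * beta / 2)) * \int[P]_t (f0 (X t) * expR (s * Y t)).
  have := cameron_martin (s *: a) mf0.
  under eq_Rintegral do rewrite -scalemxAr fE.
  rewrite RintegralD//; last 2 first.
  - by apply: I; do ![apply: all_momentsD|apply: all_momentsZ].
  - by apply: I; apply: all_momentsZ.
  rewrite RintegralD//; last 2 first.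
  - by apply: I; do ![apply: all_momentsD|apply: all_momentsZ].
  - by apply: I; apply: all_momentsZ.
  rewrite RintegralD//; last 2 first.
  - exact: I.
  - by apply: I; apply: all_momentsZ.
  rewrite !RintegralZl//; try exact: I.
  move=> ->; rewrite -RintegralZl//; last by apply: I; exact: all_momentsM.
  apply: eq_Rintegral => t _; rewrite mulrCA -expRD dotZl !bformE.
  by congr (_ * expR _); rewrite /Y /beta; field.
have taylor s : 0 <= s <= 1 ->
    `|\int[P]_t (f0 (X t) * expR (s * Y t)) - A - s * B'| <= s ^+ 2 * K.
  move=> /andP[s0 s1].
  have Is : all_moments P (fun t => f0 (X t) * expR (s * Y t)) by exact: all_momentsM.
  have IY : all_moments P (fun t => Y t * f0 (X t)) by exact: all_momentsM.
  have Ir : all_moments P (fun t => f0 (X t) * expR (s * Y t) - f0 (X t)).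
    by under eq_fun do rewrite -mulN1r; apply: all_momentsD => //; exact: all_momentsZ.
  rewrite /A /B' -RintegralZl//; last exact: I.
  rewrite -RintegralB//; [|exact: I..].
  rewrite -RintegralB//; [|exact: I|by apply: I; exact: all_momentsZ].
  have Ir2 : all_moments P
      (fun t => f0 (X t) * expR (s * Y t) - f0 (X t) - s * (Y t * f0 (X t))).
    under eq_fun do rewrite -mulNr; apply: all_momentsD => //; exact: all_momentsZ.
  apply: le_trans (le_normr_Rintegral measurableT (I _ Ir2)) _.
  rewrite /K -RintegralZl//; last exact: I.
  apply: le_Rintegral => //.
  - by apply: I; exact: all_moments_norm_fun.
  - by apply: I; exact: all_momentsZ.
  move=> t _.
  have -> : f0 (X t) * expR (s * Y t) - f0 (X t) - s * (Y t * f0 (X t)) =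
      f0 (X t) * (expR (s * Y t) - 1 - s * Y t) by ring.
  rewrite normrM /w [leRHS]mulrCA ler_wpM2l//.
  apply: le_trans (expR_taylor1 _) _; rewrite exprMn -mulrA ler_wpM2l ?sqr_ge0//.
  rewrite ler_wpM2l ?sqr_ge0// mul1r mulN1r.
  apply: (@le_trans _ _ (expR `|Y t|)).
    by rewrite ler_expR normrM (ger0_norm s0) ler_piMl.
  have := expR_ge0 (Y t); have := expR_ge0 (- Y t).
  by case: (ger0P (Y t)) => _; lra.
(* In [shift] the terms A cancel and s (B' - B) equals a quantity of order s^2: C and D come from
   the left side, K from [taylor], and beta / 2 from 1 - exp (- s^2 beta / 2), multiplied by a bound
   on J. *)
pose L := `|C| + `|D| + K + beta / 2 * (`|A| + `|B'| + K).
have bound s : 0 < s <= 1 -> `|B' - B| <= s * L.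
  move=> /andP[s0 s1]; have s01 : 0 <= s <= 1 by rewrite ltW.
  have := shift s; have := taylor s s01.
  set J := \int[P]_t (f0 (X t) * expR (s * Y t)); set e := expR _ => TJ SJ.
  have e0 : 0 <= e by exact: expR_ge0.
  have e1 : 1 - s ^+ 2 * beta / 2 <= e by exact: expR_ge1Dx.
  have e2 : e <= 1 by rewrite -expR0 ler_expR oppr_le0 divr_ge0// mulr_ge0// sqr_ge0.
  have ss : s ^+ 2 <= s by rewrite expr2 ler_piMl// ltW.
  have sss : s ^+ 3 <= s ^+ 2 by rewrite exprS ler_piMl// sqr_ge0.
  have s20 : 0 <= s ^+ 2 by exact: sqr_ge0.
  have s30 : 0 <= s ^+ 3 by rewrite exprn_ge0// ltW.
  pose r := J - A - s * B'.
  have JE : J = A + s * B' + r by rewrite /r; ring.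
  have key : s * (B' - B) = s ^+ 2 * C + s ^+ 3 * D - r + (1 - e) * J.
    by move: JE SJ; move: r => r JE SJ; lra.
  have Jle : `|J| <= `|A| + `|B'| + K.
    rewrite {1}JE; apply: le_trans (ler_normD _ _) _; apply: lerD.
      apply: le_trans (ler_normD _ _) _; apply: lerD => //.
      by rewrite normrM gtr0_norm// ler_piMl.
    apply: le_trans TJ _; rewrite ler_piMl//.
    by apply: le_trans ss _.
  rewrite -(ler_pM2l s0) -[s in leLHS]gtr0_norm// -normrM key.
  have E1 : `|s ^+ 2 * C| <= s ^+ 2 * `|C| by rewrite normrM ger0_norm.
  have E2 : `|s ^+ 3 * D| <= s ^+ 2 * `|D|.
    by rewrite normrM ger0_norm// ler_wpM2r.
  have E3 : `|(1 - e) * J| <= s ^+ 2 * beta / 2 * (`|A| + `|B'| + K).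
    rewrite normrM ger0_norm ?subr_ge0//; apply: ler_pM => //; first by rewrite subr_ge0.
    lra.
  have -> : s * (s * L) = s ^+ 2 * `|C| + s ^+ 2 * `|D| + s ^+ 2 * K +
      s ^+ 2 * beta / 2 * (`|A| + `|B'| + K) by rewrite /L; field.
  apply: le_trans (ler_normD _ _) _; apply: lerD => //.
  apply: le_trans (ler_normB _ _) _; apply: lerD => //.
  by apply: le_trans (ler_normD _ _) _; apply: lerD.
have L0 : 0 <= L.
  have b1 : `|B' - B| <= 1 * L by apply: bound; rewrite ltr01 lexx.
  by rewrite mul1r in b1; exact: le_trans b1.
apply/eqP; rewrite -/B' -/B -subr_eq0 -normr_eq0; apply: contraT => ne.
have d0 : 0 < `|B' - B| by rewrite lt_neqAle eq_sym ne/=.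
(* With this s, s L <= |B' - B| L / (2 (L + 1)) < |B' - B|; the minimum keeps s in the range of
   [bound]. *)
pose s := Num.min 1 (`|B' - B| / (2 * (L + 1))).
have L1 : 0 < 2 * (L + 1) by lra.
have s0 : 0 < s by rewrite lt_min ltr01 divr_gt0.
have := bound s (ltac:(by rewrite s0 ge_min lexx)).
have : s * (2 * (L + 1)) <= `|B' - B| by rewrite -ler_pdivlMr// ge_min lexx orbT.
nra.
Qed.

End gaussian_stein.

(** * Gaussian moments of order at most four *)

Section gaussian_moments.
Set Implicit Arguments.
Unset Strict Implicit.
Context {disp : measure_display} {T : measurableType disp} {R : realType}.
Variable P : probability T R.
Variables (n : nat) (Gamma : 'M[R]_n) (Gamma_pos : posdefmx Gamma).
Variable X : {RV P >-> 'cV[R]_n}.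
Hypothesis X_law : has_law X (mvnormal_prob 0 Gamma).
Implicit Types a b c d : 'cV[R]_n.

Lemma all_moments_gaussian a : all_moments P (fun t => dot a (X t)).
Proof.
apply: all_moments_exp_integrable; last exact: (mvnormal_exp_integrable Gamma_pos X_law a).
by apply: (measurableT_comp (measurable_dot a)).
Qed.

Let dot_shift a b v s : dot b (v + s *: (Gamma *m a)) = dot b v + s * bform Gamma b a.
Proof. by rewrite dotD dotZ -bform_mulr. Qed.

Let cst0 := @all_moments_cst _ _ _ P 0.

Lemma gaussian_moment1 a : \int[P]_t dot a (X t) = 0.
Proof.
have := @stein_identity _ _ _ P _ _ Gamma_pos X X_law a (cst 1) (cst 0) (cst 0) (cst 0).
move=> /(_ (measurable_cst _) (@all_moments_cst _ _ _ P 1) cst0 cst0 cst0) H.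
rewrite -[RHS](_ : \int[P]_t (cst 0 (X t)) = 0); last by rewrite Rintegral_cst// mul0r.
rewrite -H; last by move=> v s; rewrite /cst !mulr0 !addr0.
by apply: eq_Rintegral => t _; rewrite mulr1.
Qed.

Lemma gaussian_moment2 a b : \int[P]_t (dot a (X t) * dot b (X t)) = bform Gamma a b.
Proof.
have [GT _] := Gamma_pos.
rewrite (@stein_identity _ _ _ P _ _ Gamma_pos X X_law a (dot b)
  (cst (bform Gamma b a)) (cst 0) (cst 0)) //.
- by rewrite Rintegral_cst//= probability_setT mulr1 bformC.
- exact: measurable_dot.
- exact: all_moments_gaussian.
- exact: all_moments_cst.
- by move=> v s; rewrite dot_shift !mulr0 !addr0.
Qed.

Lemma gaussian_moment3 a b c :
  \int[P]_t (dot a (X t) * (dot b (X t) * dot c (X t))) = 0.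
Proof.
have M := all_moments_gaussian; have I f := @all_moments_integrable _ _ _ P f.
rewrite (@stein_identity _ _ _ P _ _ Gamma_pos X X_law a (fun v => dot b v * dot c v)
  (fun v => bform Gamma b a * dot c v + bform Gamma c a * dot b v)
  (cst (bform Gamma b a * bform Gamma c a)) (cst 0)) //.
- rewrite RintegralD//; [|by apply: I; exact: all_momentsZ..].
  by rewrite !RintegralZl//; [|exact: I..]; rewrite !gaussian_moment1 !mulr0 addr0.
- by apply: measurable_funM; exact: measurable_dot.
- exact: all_momentsM.
- by apply: all_momentsD; exact: all_momentsZ.
- exact: all_moments_cst.
- by move=> v s; rewrite !dot_shift /cst; ring.
Qed.

(** Isserlis' formula: Stein's identity removes the factor a, and differentiating the other three
    along Gamma a leaves second moments. *)
Lemma gaussian_moment4 a b c d :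
  \int[P]_t (dot a (X t) * (dot b (X t) * (dot c (X t) * dot d (X t)))) =
  bform Gamma a b * bform Gamma c d + bform Gamma a c * bform Gamma b d +
  bform Gamma a d * bform Gamma b c.
Proof.
have [GT _] := Gamma_pos.
have M := all_moments_gaussian; have I f := @all_moments_integrable _ _ _ P f.
pose B := bform Gamma.
rewrite (@stein_identity _ _ _ P _ _ Gamma_pos X X_law a
  (fun v => dot b v * (dot c v * dot d v))
  (fun v => B b a * (dot c v * dot d v) + B c a * (dot b v * dot d v) +
            B d a * (dot b v * dot c v))
  (fun v => B b a * B c a * dot d v + B b a * B d a * dot c v + B c a * B d a * dot b v)
  (cst (B b a * B c a * B d a))) //.
- rewrite RintegralD//; last 2 first.
  + by apply: I; apply: all_momentsD; apply: all_momentsZ; exact: all_momentsM.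
  + by apply: I; apply: all_momentsZ; exact: all_momentsM.
  rewrite RintegralD//; [|by apply: I; apply: all_momentsZ; exact: all_momentsM..].
  rewrite !RintegralZl//; [|by apply: I; exact: all_momentsM..].
  by rewrite !gaussian_moment2 /B !(bformC _ a GT).
- by do !apply: measurable_funM; exact: measurable_dot.
- by do !apply: all_momentsM.
- by do !apply: all_momentsD; apply: all_momentsZ; exact: all_momentsM.
- by do !apply: all_momentsD; exact: all_momentsZ.
- exact: all_moments_cst.
- by move=> v s; rewrite !dot_shift /cst /B; ring.
Qed.

End gaussian_moments.

(** * Expectation of products of independent variables *)

Section independence.
Set Implicit Arguments.
Unset Strict Implicit.
Context {disp : measure_display} {T : measurableType disp} {R : realType}.
Variable P : probability T R.
Context {d1 d2 : measure_display} {T1 : measurableType d1} {T2 : measurableType d2}.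
Variables (U : {RV P >-> T1}) (V : {RV P >-> T2}).
Hypothesis UV : independent_rv P U V.

(** Independence says that the joint law and the product of the marginal laws agree on rectangles,
    hence everywhere; Fubini then separates the integrals. *)
Lemma independent_expectationM (f : T1 -> R) (g : T2 -> R) :
  measurable_fun setT f -> measurable_fun setT g ->
  all_moments P (f \o U) -> all_moments P (g \o V) ->
  \int[P]_t (f (U t) * g (V t)) = \int[P]_t f (U t) * \int[P]_t g (V t).
Proof.
move=> mf mg fU gV.
have I h := @all_moments_integrable _ _ _ P h.
have mU : measurable_fun setT U by []. have mV : measurable_fun setT V by [].
have mUV : measurable_fun setT (fun t => (U t, V t)) by exact: measurable_fun_pair.
pose J0 : {measure set (T1 * T2) -> \bar R} := pushforward P (fun t => (U t, V t)).
pose J := J0 mUV.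
pose muU := distribution P U; pose muV := distribution P V.
have JE A : measurable A -> (muU \x muV)%E A = J A.
  apply: product_measure_unique => B C mB mC.
  by rewrite /J /= /pushforward -UV.
pose h (z : T1 * T2) := (f z.1 * g z.2)%:E.
have mh : measurable_fun setT h.
  apply/measurable_EFinP; apply: measurable_funM.
    exact: (measurableT_comp mf measurable_fst).
  exact: (measurableT_comp mg measurable_snd).
have ihP : P.-integrable setT (h \o (fun t => (U t, V t))).
  exact: (I _ (all_momentsM fU gV)).
have ihJ : J.-integrable setT h.
  by apply: (integrable_pushforward mUV mh) => //.
have ih : (muU \x muV)%E.-integrable setT h.
  apply/integrableP; split => //; move/integrableP : ihJ => [_].
  by rewrite (eq_measure_integral (muU \x muV)%E)// => A mA _; exact/esym/JE.
have igV : P.-integrable setT ((EFin \o g) \o V) by exact: (I _ gV).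
have ifU : P.-integrable setT ((EFin \o f) \o U) by exact: (I _ fU).
have mgE : measurable_fun setT (EFin \o g) by exact/measurable_EFinP.
have mfE : measurable_fun setT (EFin \o f) by exact/measurable_EFinP.
have gE : (\int[muV]_y (g y)%:E = (\int[P]_t g (V t))%:E)%E.
  rewrite fineK; last exact: integrable_fin_num igV.
  exact: (integral_pushforward mV mgE igV measurableT).
have fE : (\int[muU]_y (f y)%:E = (\int[P]_t f (U t))%:E)%E.
  rewrite fineK; last exact: integrable_fin_num ifU.
  exact: (integral_pushforward mU mfE ifU measurableT).
have igmu : muV.-integrable setT (EFin \o g) by exact: (integrable_pushforward mV mgE igV).
have ifmu : muU.-integrable setT (EFin \o f) by exact: (integrable_pushforward mU mfE ifU).
suff H : (\int[P]_t (f (U t) * g (V t))%:E =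
    (\int[P]_t f (U t))%:E * (\int[P]_t g (V t))%:E)%E.
  by rewrite {1}/Rintegral H.
transitivity (\int[J]_z h z)%E.
  exact/esym/(integral_pushforward mUV mh ihP measurableT).
transitivity (\int[muU \x muV]_z h z)%E.
  by apply: eq_measure_integral => A mA _; exact/esym/JE.
rewrite -(integral12_prod_meas1 ih).
transitivity (\int[muU]_x ((\int[P]_t g (V t))%:E * (f x)%:E))%E.
  apply: eq_integral => x _; rewrite /fubini_F /h /=.
  under eq_integral do rewrite EFinM.
  by rewrite integralZl// gE muleC.
by rewrite integralZl// fE muleC.
Qed.

End independence.

(** * The truncated component *)

Section truncated_gaussian.
Set Implicit Arguments.
Unset Strict Implicit.
Context {disp : measure_display} {T : measurableType disp} {R : realType}.
Variable P : probability T R.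
Variables (n : nat) (Gamma : 'M[R]_n) (Gamma_pos : posdefmx Gamma) (tau : 'cV[R]_n).
Variables W U : {RV P >-> 'cV[R]_n}.
Hypothesis W_law : has_law W (mvnormal_prob 0 Gamma).
Hypothesis U_law : has_law U
  (fun A => cond_prob P (W @^-1` A) [set t | pos_cV (W t + tau)]).
Notation C := (shifted_orthant tau).
Notation w := (orthant_weight Gamma tau).
Notation "\int_ x f" := (\int[lebesgue_cV n]_x f)%E (at level 36, x name, f at level 36).

(** k is the Gaussian constant divided by the probability of the conditioning event. Its positivity
    is deduced later, from the total mass of U. *)
Lemma truncated_law_density : exists2 k : R, 0 <= k &
  has_law U (fun A => \int[lebesgue_cV n]_(x in A) (k * w x)%:E)%E.
Proof.
have mC := measurable_shifted_orthant tau.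
pose c := (Num.sqrt ((2 * pi) ^+ n * \det Gamma))^-1 : R.
have c0 : 0 <= c by rewrite invr_ge0 sqrtr_ge0.
pose N := fine (P (W @^-1` C)).
have N0 : 0 <= N by rewrite fine_ge0.
exists (c / N); first by rewrite divr_ge0.
move=> A mA; rewrite (U_law mA) /cond_prob.
have mAC : measurable (A `&` C) by exact: measurableI.
rewrite -/(W @^-1` C) -/N -preimage_setI.
have E1 : P (W @^-1` (A `&` C)) = (\int[lebesgue_cV n]_(x in A) (c * w x)%:E)%E.
  apply: etrans (mvnormal_law_gaussian_exp W_law mAC) _.
  rewrite integral_mkcondr; apply: eq_integral => x _.
  rewrite /w patchE indicE; case: ifP => _; first by rewrite mul1r.
  by rewrite mul0r mulr0.
have fin1 : P (W @^-1` (A `&` C)) \is a fin_num.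
  apply: fin_num_measure; rewrite -[X in measurable X]setTI.
  exact: (measurable_funP W).
have mw : measurable_fun A (fun x => (c * w x)%:E).
  apply: measurable_funTS; apply/measurable_EFinP; apply: measurable_funM => //.
  exact: measurable_orthant_weight.
have w0 x : A x -> (0 <= (c * w x)%:E)%E.
  by rewrite lee_fin mulr_ge0// orthant_weight_ge0.
transitivity ((N^-1)%:E * P (W @^-1` (A `&` C)))%E.
  by rewrite EFinM fineK// muleC.
rewrite E1 -(ge0_integralZl (lebesgue_cV n) mA mw w0); last by rewrite lee_fin invr_ge0.
by apply: eq_integral => x _; rewrite -EFinM; congr (_%:E); ring.
Qed.

Lemma truncated_exp_integrable a : exp_integrable P (fun t => dot a (U t)).
Proof.
have [k k0 Uk] := truncated_law_density.
exact: (exp_integrable_dot Gamma_pos (measurable_shifted_orthant tau) k0 Uk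
  (mvnormal_total_fin W_law)).
Qed.

Lemma all_moments_truncated a : all_moments P (fun t => dot a (U t)).
Proof.
apply: all_moments_exp_integrable; last exact: truncated_exp_integrable.
by apply: (measurableT_comp (measurable_dot a)).
Qed.

(** T may carry no independent copy of U, so E (a.(U - U'))^2 = 2 var (a.U) is realised as a double
    integral against the density of U. *)
Lemma truncated_variance_lt a : a != 0 ->
  \int[P]_t (dot a (U t) * dot a (U t)) - (\int[P]_t dot a (U t)) ^+ 2 < bform Gamma a a.
Proof.
move=> a0; have s0 : 0 < bform Gamma a a by have [_ +] := Gamma_pos; exact.
have [k k0 Uk] := truncated_law_density.
have mw := measurable_orthant_weight Gamma tau; have w0 := orthant_weight_ge0 Gamma tau.
have mwE : measurable_fun setT (fun x => (w x)%:E) by exact/measurable_EFinP.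
have mkw : measurable_fun setT (fun x => k * w x) by exact: measurable_funM.
have kw0 x : 0 <= k * w x by exact: mulr_ge0.
have I f := @all_moments_integrable _ _ _ P f.
have MY := all_moments_truncated a; have MY2 := all_momentsM MY MY.
set m1 := \int[P]_t dot a (U t).
set m2 := \int[P]_t (dot a (U t) * dot a (U t)).
have EU := ge0_expectation_density mkw kw0 Uk.
have Z1 : (k%:E * \int_x (w x)%:E = 1)%E.
  rewrite -ge0_integralZl//; last by move=> x _; rewrite lee_fin.
  have := EU (cst 1%E) (measurable_cst _) (fun=> lee01).
  rewrite integral_cst//= probability_setT mul1e => ->.
  by apply: eq_integral => x _; rewrite mul1e.
have Z0 : (0 <= \int_x (w x)%:E)%E by apply: integral_ge0 => x _; rewrite lee_fin.
(* If W + tau > 0 had probability 0, cond_prob would be 0 everywhere by the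
   convention x / 0 = 0, so that U could not have this law. *)
have kgt0 : 0 < k.
  rewrite lt_neqAle k0 andbT eq_sym; apply/negP => /eqP kz; move: Z1.
  by rewrite kz mul0e => /eqP; rewrite eqe eq_sym oner_eq0.
have Zfin : (\int_x (w x)%:E < +oo)%E.
  move: Z0 Z1; case: (\int_x _)%E => [r| |]//; rewrite ?ltry// => _.
  by rewrite gt0_muley// lte_fin.
(* Integrating out the copy U' with a.U = r held fixed; [outer] then integrates over U. *)
have inner r : (\int[P]_t ((r - dot a (U t)) ^+ 2)%:E = (r ^+ 2 - 2 * r * m1 + m2)%:E)%E.
  have -> : r ^+ 2 - 2 * r * m1 + m2 =
      \int[P]_t (cst (r ^+ 2) t + (- (2 * r) * dot a (U t) + dot a (U t) * dot a (U t))).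
    rewrite RintegralD//; last 2 first.
    - by apply: I; exact: all_moments_cst.
    - by apply: I; apply: all_momentsD => //; exact: all_momentsZ.
    rewrite RintegralD//; [|by apply: I; exact: all_momentsZ|exact: I].
    rewrite Rintegral_cst//= probability_setT mulr1 RintegralZl//; last exact: I.
    by rewrite -/m1 -/m2; ring.
  rewrite fineK; first by apply: eq_integral => t _; congr (_%:E); rewrite /cst; ring.
  apply: integrable_fin_num => //; apply: I.
  apply: all_momentsD; first exact: all_moments_cst.
  by apply: all_momentsD => //; exact: all_momentsZ.
have outer : (\int[P]_t (dot a (U t) ^+ 2 - 2 * dot a (U t) * m1 + m2)%:E =
    (2 * (m2 - m1 ^+ 2))%:E)%E.
  have -> : 2 * (m2 - m1 ^+ 2) =
      \int[P]_t (dot a (U t) * dot a (U t) + (- (2 * m1) * dot a (U t) + cst m2 t)).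
    rewrite RintegralD//; [|exact: I|]; last first.
      by apply: I; apply: all_momentsD; [exact: all_momentsZ|exact: all_moments_cst].
    rewrite RintegralD//; [|by apply: I; exact: all_momentsZ|by apply: I; exact: all_moments_cst].
    rewrite Rintegral_cst//= probability_setT mulr1 RintegralZl//; last exact: I.
    by rewrite -/m1 -/m2; ring.
  rewrite fineK; first by apply: eq_integral => t _; congr (_%:E); rewrite /cst; ring.
  apply: integrable_fin_num => //; apply: I.
  apply: all_momentsD => //; apply: all_momentsD; first exact: all_momentsZ.
  exact: all_moments_cst.
have mda := measurable_dot a.
have two : (k%:E * (k%:E * \int_x \int_y ((dot a x - dot a y) ^+ 2 * (w x * w y))%:E) =
    (2 * (m2 - m1 ^+ 2))%:E)%E.
  pose F x : \bar R := (dot a x ^+ 2 - 2 * dot a x * m1 + m2)%:E.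
  have mF : measurable_fun setT F.
    apply/measurable_EFinP; apply: measurable_funD => //; apply: measurable_funB.
      exact: measurable_funX.
    by apply: measurable_funM => //; exact: measurable_funM.
  have F0 x : (0 <= F x)%E.
    by rewrite /F -inner integral_ge0// => t _; rewrite lee_fin sqr_ge0.
  have sq0 x y : (0 <= ((dot a x - dot a y) ^+ 2)%:E)%E by rewrite lee_fin sqr_ge0.
  have msq x : measurable_fun setT (fun y => ((dot a x - dot a y) ^+ 2)%:E).
    by apply/measurable_EFinP; apply: measurable_funX; exact: measurable_funB.
  have hE x : (\int_y ((dot a x - dot a y) ^+ 2 * (w x * w y))%:E =
      (k^-1)%:E * (F x * (w x)%:E))%E.
    rewrite /F -inner (EU _ (msq x) (sq0 x)).
    have mi : measurable_fun setT
        (fun y => ((dot a x - dot a y) ^+ 2)%:E * (k * w y)%:E)%E.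
      by apply: emeasurable_funM => //; exact/measurable_EFinP.
    have i0 y : setT y -> (0 <= ((dot a x - dot a y) ^+ 2)%:E * (k * w y)%:E)%E.
      by move=> _; rewrite mule_ge0// lee_fin.
    rewrite muleC -muleA -EFinM muleC.
    rewrite -(ge0_integralZl (lebesgue_cV n) measurableT mi i0); last first.
      by rewrite lee_fin mulr_ge0// invr_ge0.
    apply: eq_integral => y _; rewrite -!EFinM; congr (_%:E).
    by field; rewrite gt_eqF.
  under eq_integral do rewrite hE.
  have mFw : measurable_fun setT (fun x => F x * (w x)%:E)%E by exact: emeasurable_funM.
  have Fw0 x : setT x -> (0 <= F x * (w x)%:E)%E by move=> _; rewrite mule_ge0// lee_fin.
  rewrite ge0_integralZl// ?lee_fin ?invr_ge0// (muleA k%:E (k^-1)%:E).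
  rewrite -EFinM divff ?gt_eqF// mul1e -outer -/F (EU F mF F0).
  rewrite -ge0_integralZl//; apply: eq_integral => x _.
  by rewrite muleCA -EFinM.
have := orthant_variance_lt Gamma_pos s0 Zfin.
(* One factor k for each of the two integrals: k times the mass of [w] is 1 by [Z1]. *)
rewrite -(lte_pmul2l (z := k%:E))// ?lte_fin// -(lte_pmul2l (z := k%:E))// ?lte_fin//.
rewrite two (muleCA k%:E (2 * _)%:E) (muleCA k%:E (2 * _)%:E).
move: Z1; set Z := (\int_x (w x)%:E)%E => Z1.
rewrite (muleA k%:E Z) Z1 mul1e Z1 mule1 lte_fin.
lra.
Qed.

End truncated_gaussian.

(** * Moment matrices *)

Section kronecker_entries.
Set Implicit Arguments.
Unset Strict Implicit.
Context {R : realType}.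

Lemma sum_mxtens p q (F : 'I_(p * q) -> R) :
  \sum_k F k = \sum_(i < p) \sum_(j < q) F (mxtens_index (i, j)).
Proof.
rewrite pair_bigA /= (reindex (@mxtens_index p q)); last first.
  by exists (@mxtens_unindex p q) => k _; rewrite (mxtens_indexK, mxtens_unindexK).
by apply: eq_bigr => -[i j].
Qed.

Lemma tens_cVE n p q (x : 'cV[R]_n) (M : 'M[R]_(p, q)) i k j :
  tens_cV x M (mxtens_index (i, k)) j = x i 0 * M k j.
Proof.
rewrite /tens_cV castmxE cast_ord_id /=.
rewrite (_ : cast_ord _ j = mxtens_index (0 : 'I_1, j)); last exact: val_inj.
by rewrite tensmxE.
Qed.

Lemma vecE m n (M : 'M[R]_(m, n)) i k : vec M (mxtens_index (i, k)) 0 = M k i.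
Proof. by rewrite mxE mxtens_indexK. Qed.

Lemma commutation_mxE p q (i : 'I_p) (k : 'I_q) (j : 'I_q) (l : 'I_p) :
  (commutation_mx p q : 'M[R]_(_, _)) (mxtens_index (i, k)) (mxtens_index (j, l)) =
  ((i == l) && (k == j))%:R.
Proof.
rewrite /commutation_mx summxE (bigD1 i)//= [X in _ + X]big1 ?addr0; last first.
  move=> a ai; rewrite summxE big1// => b _.
  by rewrite tensmxE !mxE eq_sym (negbTE ai) mul0r.
rewrite summxE (bigD1 j)//= [X in _ + X]big1 ?addr0; last first.
  move=> b bj; rewrite tensmxE !mxE [j == b]eq_sym (negbTE bj) andbF mul0r//.
by rewrite tensmxE !mxE !eqxx mul1r [l == i]eq_sym.
Qed.

Lemma commutation_mulmxE p q r (M : 'M[R]_(q * p, r)) i k c :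
  (commutation_mx p q *m M) (mxtens_index (i, k)) c = M (mxtens_index (k, i)) c.
Proof.
rewrite mxE sum_mxtens (bigD1 k)//= [X in _ + X]big1 ?addr0; last first.
  move=> j jk; rewrite big1// => l _.
  by rewrite commutation_mxE [k == j]eq_sym (negbTE jk) andbF mul0r.
rewrite (bigD1 i)//= [X in _ + X]big1 ?addr0; last first.
  by move=> l li; rewrite commutation_mxE [i == l]eq_sym (negbTE li) mul0r.
by rewrite commutation_mxE !eqxx mul1r.
Qed.

Lemma tensmx_mul_tens_cV n n' p p' q (A : 'M[R]_(n, n')) (B : 'M[R]_(p, p'))
    (x : 'cV[R]_n') (M : 'M[R]_(p', q)) :
  (A *t B) *m tens_cV x M = tens_cV (A *m x) (B *m M).
Proof.
apply/matrixP => s j; case: (mxtens_indexP s) => i k.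
rewrite tens_cVE !mxE sum_mxtens mulr_suml; apply: eq_bigr => a _.
rewrite mulr_sumr; apply: eq_bigr => b _.
by rewrite tensmxE tens_cVE mulrACA.
Qed.

Lemma tens_cV_mulmx n p q r (x : 'cV[R]_n) (M : 'M[R]_(p, q)) (B : 'M[R]_(q, r)) :
  tens_cV x M *m B = tens_cV x (M *m B).
Proof.
apply/matrixP => s j; case: (mxtens_indexP s) => i k.
rewrite tens_cVE !mxE mulr_sumr; apply: eq_bigr => a _.
by rewrite tens_cVE mulrA.
Qed.

Lemma mulmx_dot m n (M : 'M[R]_(m, n)) (x : 'cV[R]_n) i :
  (M *m x) i 0 = dot (row i M)^T x.
Proof. by rewrite /dot trmxK -row_mul [RHS]mxE. Qed.

(** The left side is the covariance of coordinates i of M V and j of N V for a standard normal V;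
    with M = N = [sqrtPsi] it yields Psi. *)
Lemma dot_row_mulmx m n p (M : 'M[R]_(m, n)) (N : 'M[R]_(p, n)) i j :
  bform 1%:M (row i M)^T (row j N)^T = (M *m N^T) i j.
Proof.
rewrite /bform mulmx1 trmxK tr_row -row_mul !mxE.
by apply: eq_bigr => k _; rewrite !mxE.
Qed.

Lemma posdefmx1 n : posdefmx (1%:M : 'M[R]_n).
Proof.
split; first exact: trmx1.
move=> x x0; rewrite mulmx1 -/(dot x x) lt_neqAle dot_ge0 andbT eq_sym.
by apply: contraNneq x0 => /dot_eq0 ->.
Qed.

End kronecker_entries.

Section moment_matrices.
Set Implicit Arguments.
Unset Strict Implicit.
Context {disp : measure_display} {T : measurableType disp} {R : realType}.
Variable P : probability T R.

Definition all_moments_mx p q (M : T -> 'M[R]_(p, q)) :=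
  forall i j, all_moments P (fun t => M t i j).

Lemma expectation_mxE p q (M : T -> 'M[R]_(p, q)) i j :
  expectation_mx P M i j = \int[P]_t (M t i j).
Proof. by rewrite mxE unlock. Qed.

Lemma Rintegral_sum (I : finType) (f : I -> T -> R) :
  (forall i, all_moments P (f i)) -> \int[P]_t (\sum_i f i t) = \sum_i \int[P]_t f i t.
Proof.
move=> hf; elim: (index_enum I) => [|i s IH].
  by under eq_Rintegral do rewrite big_nil; rewrite big_nil Rintegral_cst// mul0r.
under eq_Rintegral do rewrite big_cons; rewrite big_cons -IH RintegralD//.
  exact: all_moments_integrable.
by apply: all_moments_integrable; exact: all_moments_sum.
Qed.

Lemma all_moments_mx_mulmxl p q r (A : 'M[R]_(r, p)) (M : T -> 'M[R]_(p, q)) :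
  all_moments_mx M -> all_moments_mx (fun t => A *m M t).
Proof.
move=> hM i j; under eq_fun do rewrite mxE.
by apply: all_moments_sum => k; exact: all_momentsZ.
Qed.

Lemma expectation_mulmxl p q r (A : 'M[R]_(r, p)) (M : T -> 'M[R]_(p, q)) :
  all_moments_mx M -> expectation_mx P (fun t => A *m M t) = A *m expectation_mx P M.
Proof.
move=> hM; apply/matrixP => i j; rewrite expectation_mxE mxE.
under eq_Rintegral do rewrite mxE.
rewrite Rintegral_sum; last by move=> k; exact: all_momentsZ.
apply: eq_bigr => k _; rewrite expectation_mxE RintegralZl//.
exact: all_moments_integrable.
Qed.

Lemma expectation_mulmxr p q r (M : T -> 'M[R]_(p, q)) (B : 'M[R]_(q, r)) :
  all_moments_mx M -> expectation_mx P (fun t => M t *m B) = expectation_mx P M *m B.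
Proof.
move=> hM; apply/matrixP => i j; rewrite expectation_mxE mxE.
under eq_Rintegral do (rewrite mxE; under eq_bigr do rewrite mulrC).
rewrite Rintegral_sum; last by move=> k; exact: all_momentsZ.
apply: eq_bigr => k _; rewrite expectation_mxE RintegralZl//; first by rewrite mulrC.
exact: all_moments_integrable.
Qed.

Lemma all_moments_mx_integrable p q (M : T -> 'M[R]_(p, q)) :
  all_moments_mx M -> integrable_mx P M.
Proof. by move=> hM i j; exact: all_moments_integrable (hM i j). Qed.

Lemma outerE n (X : T -> 'cV[R]_n) t i j : outer X t i j = X t i 0 * X t j 0.
Proof. by rewrite /outer mxE big_ord1 mxE. Qed.

Section coordinates.
Variables (n : nat) (X : T -> 'cV[R]_n).
Hypothesis hX : forall i, all_moments P (fun t => X t i 0).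

Lemma all_moments_mx_cV : all_moments_mx X.
Proof. by move=> i j; rewrite (ord1 j). Qed.

Lemma all_moments_mx_outer : all_moments_mx (outer X).
Proof. by move=> i j; under eq_fun do rewrite outerE; exact: all_momentsM. Qed.

Lemma all_moments_mx_tens3 : all_moments_mx (fun t => tens_cV (X t) (outer X t)).
Proof.
move=> s j; case: (mxtens_indexP s) => i k; under eq_fun do rewrite tens_cVE.
by apply: all_momentsM => //; exact: all_moments_mx_outer.
Qed.

Lemma all_moments_mx_tens4 : all_moments_mx (fun t => outer X t *t outer X t).
Proof.
move=> s s'; case: (mxtens_indexP s) => i k; case: (mxtens_indexP s') => j l.
under eq_fun do rewrite tensmxE.
by apply: all_momentsM; exact: all_moments_mx_outer.
Qed.

Lemma all_moments_moments4_exist : moments4_exist P X.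
Proof.
split; apply: all_moments_mx_integrable.
- exact: all_moments_mx_cV.
- exact: all_moments_mx_outer.
- exact: all_moments_mx_tens3.
- exact: all_moments_mx_tens4.
Qed.

Lemma mu1E i : mu1 P X i 0 = \int[P]_t (X t i 0).
Proof. exact: expectation_mxE. Qed.

Lemma mu2E i j : mu2 P X i j = \int[P]_t (X t i 0 * X t j 0).
Proof. by rewrite expectation_mxE; apply: eq_Rintegral => t _; rewrite outerE. Qed.

Lemma mu3E i k j : mu3 P X (mxtens_index (i, k)) j =
  \int[P]_t (X t i 0 * (X t k 0 * X t j 0)).
Proof.
by rewrite expectation_mxE; apply: eq_Rintegral => t _; rewrite tens_cVE outerE.
Qed.

Lemma mu4E i k j l : mu4 P X (mxtens_index (i, k)) (mxtens_index (j, l)) =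
  \int[P]_t (X t i 0 * X t j 0 * (X t k 0 * X t l 0)).
Proof.
by rewrite expectation_mxE; apply: eq_Rintegral => t _; rewrite tensmxE !outerE.
Qed.

Lemma variance_mxE : variance_mx P X = mu2 P X - mu1 P X *m (mu1 P X)^T.
Proof.
have L1 (f : T -> R) : all_moments P f -> f \in Lfun P 1.
  by move=> hf; apply/Lfun1_integrable; exact: all_moments_integrable.
apply/matrixP => i j; rewrite [LHS]mxE covarianceE; [|exact: L1..|]; last first.
  by apply: L1; exact: all_momentsM.
have fE (f : T -> R) : all_moments P f -> ('E_P[f] = (\int[P]_t f t)%:E)%E.
  move=> hf; rewrite unlock fineK//.
  by apply: integrable_fin_num => //; exact: all_moments_integrable.
have -> : (mu2 P X - mu1 P X *m (mu1 P X)^T) i j = mu2 P X i j - mu1 P X i 0 * mu1 P X j 0.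
  by rewrite !mxE big_ord1 !mxE.
rewrite !fE//; last exact: all_momentsM.
by rewrite -EFinM -EFinB /= mu2E !mu1E.
Qed.

Variables (m : nat) (A : 'M[R]_(m, n)).

Lemma mu1_mulmx : mu1 P (fun t => A *m X t) = A *m mu1 P X.
Proof. exact: expectation_mulmxl all_moments_mx_cV. Qed.

Lemma outer_mulmx t : outer (fun t => A *m X t) t = A *m outer X t *m A^T.
Proof. by rewrite /outer trmx_mul !mulmxA. Qed.

Lemma mu2_mulmx : mu2 P (fun t => A *m X t) = A *m mu2 P X *m A^T.
Proof.
rewrite -expectation_mulmxl; last exact: all_moments_mx_outer.
rewrite -expectation_mulmxr; last exact/all_moments_mx_mulmxl/all_moments_mx_outer.
by congr expectation_mx; apply/funext => t; rewrite outer_mulmx.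
Qed.

Lemma mu3_mulmx : mu3 P (fun t => A *m X t) = (A *t A) *m mu3 P X *m A^T.
Proof.
rewrite -expectation_mulmxl; last exact: all_moments_mx_tens3.
rewrite -expectation_mulmxr; last exact/all_moments_mx_mulmxl/all_moments_mx_tens3.
congr expectation_mx; apply/funext => t.
by rewrite outer_mulmx tensmx_mul_tens_cV tens_cV_mulmx.
Qed.

Lemma mu4_mulmx : mu4 P (fun t => A *m X t) = (A *t A) *m mu4 P X *m (A *t A)^T.
Proof.
rewrite -expectation_mulmxl; last exact: all_moments_mx_tens4.
rewrite -expectation_mulmxr; last exact/all_moments_mx_mulmxl/all_moments_mx_tens4.
congr expectation_mx; apply/funext => t.
by rewrite outer_mulmx trmx_tens !tensmx_mul.
Qed.

End coordinates.
End moment_matrices.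

(** * Moments of a sum of independent vectors *)

Section signal_plus_noise.
Set Implicit Arguments.
Unset Strict Implicit.
Context {disp : measure_display} {T : measurableType disp} {R : realType}.
Variable P : probability T R.
Variables (d : nat) (A Y : T -> 'cV[R]_d) (Psi : 'M[R]_d).
Notation a i t := (A t i 0).
Notation y i t := (Y t i 0).
Hypothesis MA : forall i, all_moments P (fun t => a i t).
Hypothesis MY : forall i, all_moments P (fun t => y i t).
Hypothesis AY : forall f g : 'cV[R]_d -> R,
  measurable_fun setT f -> measurable_fun setT g ->
  all_moments P (fun t => f (A t)) -> all_moments P (fun t => g (Y t)) ->
  \int[P]_t (f (A t) * g (Y t)) = \int[P]_t f (A t) * \int[P]_t g (Y t).
Hypothesis Y1 : forall i, \int[P]_t y i t = 0.
Hypothesis Y2 : forall i j, \int[P]_t (y i t * y j t) = Psi i j.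
Hypothesis Y3 : forall i j k, \int[P]_t (y i t * (y j t * y k t)) = 0.
Hypothesis Y4 : forall i j k l, \int[P]_t (y i t * (y j t * (y k t * y l t))) =
  Psi i j * Psi k l + Psi i k * Psi j l + Psi i l * Psi j k.

Let ID f g : all_moments P f -> all_moments P g ->
  \int[P]_t (f t + g t) = \int[P]_t f t + \int[P]_t g t.
Proof. by move=> hf hg; rewrite RintegralD//; exact: all_moments_integrable. Qed.

Let mc i : measurable_fun setT (fun v : 'cV[R]_d => v i 0).
Proof. exact: measurable_coord. Qed.

(** The names of these facts spell the pattern of factors; odd patterns in y vanish by [Y1] and
    [Y3]. *)
Let ay i j : \int[P]_t (a i t * y j t) = 0.
Proof. by rewrite (AY (mc i) (mc j))// Y1 mulr0. Qed.

Let aay i j k : \int[P]_t (a i t * a j t * y k t) = 0.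
Proof.
rewrite (AY (measurable_funM (mc i) (mc j)) (mc k))//; first by rewrite Y1 mulr0.
exact: all_momentsM.
Qed.

Let ayy i j k : \int[P]_t (a i t * (y j t * y k t)) = (\int[P]_t a i t) * Psi j k.
Proof.
rewrite (AY (mc i) (measurable_funM (mc j) (mc k)))//; first by rewrite Y2.
exact: all_momentsM.
Qed.

Let aaay i j k l : \int[P]_t (a i t * a j t * a k t * y l t) = 0.
Proof.
rewrite (AY (measurable_funM (measurable_funM (mc i) (mc j)) (mc k)) (mc l))//.
  by rewrite Y1 mulr0.
by do !apply: all_momentsM.
Qed.

Let aayy i j k l : \int[P]_t (a i t * a j t * (y k t * y l t)) =
  (\int[P]_t (a i t * a j t)) * Psi k l.
Proof.
rewrite (AY (measurable_funM (mc i) (mc j)) (measurable_funM (mc k) (mc l))).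
- by rewrite Y2.
- exact: all_momentsM.
- exact: all_momentsM.
Qed.

Let ayyy i j k l : \int[P]_t (a i t * (y j t * (y k t * y l t))) = 0.
Proof.
rewrite (AY (mc i) (measurable_funM (mc j) (measurable_funM (mc k) (mc l))))//.
  by rewrite Y3 mulr0.
by do !apply: all_momentsM.
Qed.

Notation x i t := (a i t + y i t).

Ltac solve_moments :=
  by do ?[exact: MA | exact: MY | apply: all_momentsD | apply: all_momentsM].

Lemma sum_moment1 i : \int[P]_t x i t = \int[P]_t a i t.
Proof. by rewrite ID// Y1 addr0. Qed.

Lemma sum_moment2 i j : \int[P]_t (x i t * x j t) = \int[P]_t (a i t * a j t) + Psi i j.
Proof.
transitivity (\int[P]_t (a i t * a j t + (a i t * y j t + (a j t * y i t + y i t * y j t)))).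
  by apply: eq_Rintegral => t _; ring.
by rewrite !ID; [rewrite !ay Y2; ring|solve_moments..].
Qed.

Lemma sum_moment3 i j k : \int[P]_t (x i t * (x j t * x k t)) =
  \int[P]_t (a i t * (a j t * a k t)) + (\int[P]_t a i t) * Psi j k +
  (\int[P]_t a j t) * Psi i k + (\int[P]_t a k t) * Psi i j.
Proof.
(* Nesting to the right lets [ID] detach one term at a time, and within each term the factors from A
   precede those from Y, as [AY] expects. *)
transitivity (\int[P]_t (a i t * (a j t * a k t) + (a i t * a j t * y k t +
    (a i t * a k t * y j t + (a j t * a k t * y i t + (a i t * (y j t * y k t) +
    (a j t * (y i t * y k t) + (a k t * (y i t * y j t) + y i t * (y j t * y k t))))))))).
  by apply: eq_Rintegral => t _; ring.
by rewrite !ID; [rewrite !aay !ayy Y3; ring|solve_moments..].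
Qed.

Lemma sum_moment4 i j k l : \int[P]_t (x i t * x j t * (x k t * x l t)) =
  \int[P]_t (a i t * a j t * (a k t * a l t)) +
  (\int[P]_t (a i t * a j t)) * Psi k l + (\int[P]_t (a i t * a k t)) * Psi j l +
  (\int[P]_t (a i t * a l t)) * Psi j k + (\int[P]_t (a j t * a k t)) * Psi i l +
  (\int[P]_t (a j t * a l t)) * Psi i k + (\int[P]_t (a k t * a l t)) * Psi i j +
  (Psi i j * Psi k l + Psi i k * Psi j l + Psi i l * Psi j k).
Proof.
transitivity (\int[P]_t (a i t * a j t * (a k t * a l t) +
    (a i t * a j t * a k t * y l t + (a i t * a j t * a l t * y k t +
    (a i t * a k t * a l t * y j t + (a j t * a k t * a l t * y i t +
    (a i t * a j t * (y k t * y l t) + (a i t * a k t * (y j t * y l t) +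
    (a i t * a l t * (y j t * y k t) + (a j t * a k t * (y i t * y l t) +
    (a j t * a l t * (y i t * y k t) + (a k t * a l t * (y i t * y j t) +
    (a i t * (y j t * (y k t * y l t)) + (a j t * (y i t * (y k t * y l t)) +
    (a k t * (y i t * (y j t * y l t)) + (a l t * (y i t * (y j t * y k t)) +
     y i t * (y j t * (y k t * y l t)))))))))))))))))).
  by apply: eq_Rintegral => t _; ring.
by rewrite !ID; [rewrite !aaay !aayy !ayyy Y4; ring|solve_moments..].
Qed.

End signal_plus_noise.

Section congruence.
Context {R : realType}.

Lemma possemidefmx_congr n m (D : 'M[R]_m) (B : 'M[R]_(n, m)) :
  possemidefmx D -> possemidefmx (B *m D *m B^T).
Proof.
move=> [DT D0]; split; first by rewrite !trmx_mul trmxK DT mulmxA.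
by move=> x; have := D0 (B^T *m x); rewrite trmx_mul trmxK !mulmxA.
Qed.

Lemma posdefmx_congr n m (D : 'M[R]_m) (B : 'M[R]_(n, m)) :
  posdefmx D -> (forall x : 'cV[R]_n, B^T *m x = 0 -> x = 0) -> posdefmx (B *m D *m B^T).
Proof.
move=> [DT D0] B0; split; first by rewrite !trmx_mul trmxK DT mulmxA.
move=> x x0; have : B^T *m x != 0 by apply: contraNneq x0 => /B0 ->.
by move=> /D0; rewrite trmx_mul trmxK !mulmxA.
Qed.

Lemma mulmx_trE m n (u : 'cV[R]_m) (v : 'cV[R]_n) i j : (u *m v^T) i j = u i 0 * v j 0.
Proof. by rewrite mxE big_ord1 mxE. Qed.

End congruence.

Section eq_moments.
Set Implicit Arguments.
Unset Strict Implicit.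
Context {disp : measure_display} {T : measurableType disp} {R : realType}.
Variable P : probability T R.

Lemma eq_all_moments (f g : T -> R) : f =1 g -> all_moments P g -> all_moments P f.
Proof. by move=> /funext ->. Qed.

End eq_moments.

Theorem proposition1 (R : realType) (d m : nat) (d_gt0 : (0 < d)%N) (m_gt0 : (0 < m)%N)
  (Omegabar : 'M[R]_d) (Delta : 'M[R]_(d, m)) (Gamma : 'M[R]_m)
  (corr_Omegastar : correlation_mx (block_mx Omegabar Delta Delta^T Gamma))
  (full_rank_Omegastar : \rank (block_mx Omegabar Delta Delta^T Gamma) = (d + m)%N)
  (tau : 'cV[R]_m)
  (omega : 'M[R]_d) (omega_diag : is_diag_mx omega) (omega_gt0 : forall i, 0 < omega i i)
  (Omega : 'M[R]_d) (OmegaE : Omega = omega *m Omegabar *m omega)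
  (Lambda : 'M[R]_(d, m)) (LambdaE : Lambda = omega *m Delta *m invmx Gamma)
  (Psi : 'M[R]_d)
  (PsiE : Psi = Omega - omega *m Delta *m invmx Gamma *m Delta^T *m omega)
  (sqrtPsi : 'M[R]_d) (sqrtPsiP : posdef_sqrt sqrtPsi Psi)
  (disp : measure_display) (T : measurableType disp) (P : probability T R)
  (V : {RV P >-> 'cV[R]_d}) (W U : {RV P >-> 'cV[R]_m})
  (V_law : has_law V (mvnormal_prob 0 1%:M))
  (W_law : has_law W (mvnormal_prob 0 Gamma))
  (VW_indep : independent_rv P V W)
  (UV_indep : independent_rv P U V)
  (U_law : has_law U
     (fun A => cond_prob P (W @^-1` A) [set t | pos_cV (W t + tau)]))
  (X : {RV P >-> 'cV[R]_d}) (XE : forall t, X t = Lambda *m U t + sqrtPsi *m V t)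
  (X_law : has_law X (SUN_prob 0 omega Omegabar Delta tau Gamma)) :
  [/\ moments4_exist P U /\ moments4_exist P X,
      [/\ mu1 P X = Lambda *m mu1 P U,
          mu2 P X = Lambda *m mu2 P U *m Lambda^T + Psi,
          mu3 P X = (Lambda *t Lambda) *m mu3 P U *m Lambda^T
            + (1%:M + commutation_mx d d) *m tens_cV (Lambda *m mu1 P U) Psi
            + vec Psi *m (mu1 P U)^T *m Lambda^T &
          mu4 P X = (Lambda *t Lambda) *m mu4 P U *m (Lambda *t Lambda)^T
            + vec Psi *m (vec Psi)^T
            + (1%:M + commutation_mx d d) *m
                ((Lambda *m mu2 P U *m Lambda^T) *t Psi
                 + Psi *t (Lambda *m mu2 P U *m Lambda^T)
                 + Psi *t Psi)
            + vec (Lambda *m mu2 P U *m Lambda^T) *m (vec Psi)^T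
            + vec Psi *m (vec (Lambda *m mu2 P U *m Lambda^T))^T],
      variance_mx P U = mu2 P U - mu1 P U *m (mu1 P U)^T,
      variance_mx P X = Omega - Lambda *m (Gamma - variance_mx P U) *m Lambda^T &
      possemidefmx (Omega - variance_mx P X) /\
      (\rank Delta = d -> posdefmx (Omega - variance_mx P X))].
Proof.
have [Omegastar_semi _] := corr_Omegastar.
(* A correlation matrix is only semidefinite; full rank makes it definite, and its block Gamma with
   it. *)
have Omegastar_pos : posdefmx (block_mx Omegabar Delta Delta^T Gamma).
  apply: possemidefmx_unit => //.
  by rewrite -row_free_unit /row_free full_rank_Omegastar.
have Gamma_pos : posdefmx Gamma := posdefmx_drsub Omegastar_pos.
have Gamma_unit := posdefmx_unit Gamma_pos; have [GammaT _] := Gamma_pos.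
have omegaT : omega^T = omega.
  apply/matrixP => i j; rewrite mxE; have [->//|ij] := eqVneq i j.
  by rewrite !(is_diag_mxP omega_diag)// eq_sym.
have [[sqrtPsiT sqrtPsi_gt0] sqrtPsi2] := sqrtPsiP.
have MU a := all_moments_truncated Gamma_pos W_law U_law a.
have MV a := all_moments_gaussian (posdefmx1 d) V_law a.
pose A t := Lambda *m U t; pose Y t := sqrtPsi *m V t.
have hU i : all_moments P (fun t => U t i 0).
  apply: (eq_all_moments _ (MU (row i 1%:M)^T)) => t.
  by rewrite -mulmx_dot mul1mx.
have MA i : all_moments P (fun t => A t i 0).
  by apply: (eq_all_moments _ (MU (row i Lambda)^T)) => t; rewrite -mulmx_dot.
have MY i : all_moments P (fun t => Y t i 0).
  by apply: (eq_all_moments _ (MV (row i sqrtPsi)^T)) => t; rewrite -mulmx_dot.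
have XAY t i : X t i 0 = A t i 0 + Y t i 0 by rewrite XE mxE.
have hX i : all_moments P (fun t => X t i 0).
  by apply: (eq_all_moments _ (all_momentsD (MA i) (MY i))) => t; rewrite XAY.
have AY f g : measurable_fun setT f -> measurable_fun setT g ->
    all_moments P (fun t => f (A t)) -> all_moments P (fun t => g (Y t)) ->
    \int[P]_t (f (A t) * g (Y t)) = \int[P]_t f (A t) * \int[P]_t g (Y t).
  move=> mf mg; apply: (independent_expectationM UV_indep
    (f := f \o mulmx Lambda) (g := g \o mulmx sqrtPsi)).
    by apply: (measurableT_comp mf); exact: measurable_mulmx.
  by apply: (measurableT_comp mg); exact: measurable_mulmx.
have YE t i : Y t i 0 = dot (row i sqrtPsi)^T (V t) by rewrite mulmx_dot.
have PsiB i j : bform 1%:M (row i sqrtPsi)^T (row j sqrtPsi)^T = Psi i j.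
  by rewrite dot_row_mulmx sqrtPsiT sqrtPsi2.
have Y1 i : \int[P]_t Y t i 0 = 0.
  under eq_Rintegral do rewrite YE.
  exact: (gaussian_moment1 (posdefmx1 d) V_law).
have Y2 i j : \int[P]_t (Y t i 0 * Y t j 0) = Psi i j.
  under eq_Rintegral do rewrite !YE.
  by rewrite (gaussian_moment2 (posdefmx1 d) V_law).
have Y3 i j k : \int[P]_t (Y t i 0 * (Y t j 0 * Y t k 0)) = 0.
  under eq_Rintegral do rewrite !YE.
  exact: (gaussian_moment3 (posdefmx1 d) V_law).
have Y4 i j k l : \int[P]_t (Y t i 0 * (Y t j 0 * (Y t k 0 * Y t l 0))) =
    Psi i j * Psi k l + Psi i k * Psi j l + Psi i l * Psi j k.
  under eq_Rintegral do rewrite !YE.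
  by rewrite (gaussian_moment4 (posdefmx1 d) V_law) !PsiB.
(* Psi is symmetric because it is a matrix of second moments. *)
have PsiT i j : Psi i j = Psi j i.
  by rewrite -[in LHS]Y2 -Y2; apply: eq_Rintegral => t _; rewrite mulrC.
have mu1A := mu1_mulmx hU Lambda; have mu2A := mu2_mulmx hU Lambda.
have mu3A := mu3_mulmx hU Lambda; have mu4A := mu4_mulmx hU Lambda.
have mu1X : mu1 P X = Lambda *m mu1 P U.
  apply/matrixP => i j; rewrite (ord1 j) -mu1A !mu1E//.
  under eq_Rintegral do rewrite XAY.
  exact: sum_moment1.
have mu2X : mu2 P X = Lambda *m mu2 P U *m Lambda^T + Psi.
  apply/matrixP => i j; rewrite -mu2A [RHS]mxE !mu2E//.
  under eq_Rintegral do rewrite !XAY.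
  exact: sum_moment2.
have varU : variance_mx P U = mu2 P U - mu1 P U *m (mu1 P U)^T by exact: variance_mxE.
have varX : variance_mx P X = Omega - Lambda *m (Gamma - variance_mx P U) *m Lambda^T.
  rewrite (variance_mxE hX) mu1X mu2X varU PsiE trmx_mul.
  (* Psi = Omega - Lambda Gamma Lambda', so adding Lambda (var U) Lambda' to Psi gives the stated
     form of var X. *)
  have LGL : Lambda *m Gamma *m Lambda^T =
      omega *m Delta *m invmx Gamma *m Delta^T *m omega.
    by rewrite LambdaE mulmxKV// !trmx_mul trmx_inv GammaT omegaT !mulmxA.
  rewrite -LGL !mulmxBr !mulmxBl !mulmxA.
  set a := Lambda *m mu2 P U *m Lambda^T; set b := _ *m (mu1 P U)^T *m _.
  by rewrite opprB (addrCA a) -[LHS]addrA (addrAC a).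
split => //.
- by split; exact: all_moments_moments4_exist.
- split => //.
  (* At row (i, k) and column j the identity gives a_i Psi_kj, the commutation matrix exchanges i
     and k, and the vec term gives Psi_ki a_j: the three choices of the factor taken from A. *)
  + apply/matrixP => s j; case: (mxtens_indexP s) => i k.
    rewrite -mu3A [RHS]mxE [X in X + _]mxE mu3E// mu3E//.
    rewrite mulmxDl mul1mx [X in _ + X + _]mxE commutation_mulmxE !tens_cVE -mu1A.
    under eq_Rintegral do rewrite !XAY.
    rewrite (sum_moment3 MA MY AY Y1 Y2 Y3).
    rewrite -mulmxA -trmx_mul -mu1A [X in _ = _ + X]mxE big_ord1 vecE [X in _ = _ + _ * X]mxE.
    rewrite !mu1E//.
    by rewrite (PsiT k i) /A; ring.
  (* Of the six mixed terms of [sum_moment4], four come from 1 + K_d and two from the mixed vec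
     products; of the three pairings of Y, two come from (1 + K_d)(Psi (x) Psi) and one from vec Psi
     (vec Psi)'. *)
  + apply/matrixP => s s'; case: (mxtens_indexP s) => i k; case: (mxtens_indexP s') => j l.
    rewrite -mu4A -mu2A mu4E//.
    under eq_Rintegral do rewrite !XAY.
    rewrite (sum_moment4 MA MY AY Y1 Y2 Y3 Y4).
    rewrite mulmxDl mul1mx.
    do !rewrite [(_ + _ : 'M[R]_(_, _)) _ _]mxE.
    rewrite commutation_mulmxE.
    do !rewrite [(_ + _ : 'M[R]_(_, _)) _ _]mxE.
    rewrite !mulmx_trE !vecE !tensmxE mu4E !mu2E -/A.
    have AC p q : \int[P]_t (A t p 0 * A t q 0) = \int[P]_t (A t q 0 * A t p 0).
      by apply: eq_Rintegral => t _; rewrite mulrC.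
    rewrite (AC k j) (AC k i) (AC l j) (PsiT k j) (PsiT k i) (PsiT l j) /A.
    ring.
have D_pos : posdefmx (Gamma - variance_mx P U).
  split.
    apply/matrixP => i j; rewrite !mxE covarianceC -[in LHS]GammaT mxE.
    by [].
  move=> a a0; have := truncated_variance_lt Gamma_pos W_law U_law a0.
  have -> : \int[P]_t (dot a (U t) * dot a (U t)) = (a^T *m mu2 P U *m a) 0 0.
    have := mu2_mulmx hU a^T; rewrite trmxK => <-.
    by rewrite mu2E; apply: eq_Rintegral.
  have -> : \int[P]_t dot a (U t) = (a^T *m mu1 P U) 0 0.
    by rewrite -(mu1_mulmx hU) mu1E.
  rewrite -subr_gt0; congr (0 < _); rewrite varU.
  have -> : (a^T *m mu1 P U) 0 0 ^+ 2 = (a^T *m (mu1 P U *m (mu1 P U)^T) *m a) 0 0.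
    by rewrite expr2 -mulmx_trE trmx_mul trmxK !mulmxA.
  rewrite !mulmxBr !mulmxBl /bform.
  have subE (M N : 'M[R]_1) : (M - N) 0 0 = M 0 0 - N 0 0 by rewrite !mxE.
  by rewrite !subE.
(* What remains is Lambda (Gamma - var U) Lambda'. As omega and Gamma are invertible, the kernel of
   Lambda' is trivial exactly when Delta has rank d. *)
rewrite varX opprB addrCA subrr addr0; split.
  exact/possemidefmx_congr/posdefmx_semidef.
move=> rankDelta; apply: posdefmx_congr => // x Lx.
have Dfree : row_free Delta by rewrite /row_free rankDelta.
(* Lambda' x = 0, transposed and multiplied on the right by Gamma, becomes (omega x)' Delta = 0. *)
have /(row_free_inj Dfree) ox : (omega *m x)^T *m Delta = 0 *m Delta.
  move: Lx => /(congr1 trmx); rewrite trmx_mul trmxK LambdaE trmx0.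
  move=> /(congr1 (mulmx^~ Gamma)); rewrite !mulmxA mulmxKV// !mul0mx => <-.
  by rewrite trmx_mul omegaT.
apply/matrixP => i j; rewrite (ord1 j) [RHS]mxE.
have : (omega *m x)^T 0 i = 0 by rewrite ox mxE.
rewrite !mxE (bigD1 i)//= big1 ?addr0 => [/eqP|k ki]; last first.
  by rewrite (is_diag_mxP omega_diag) ?mul0r// eq_sym.
by rewrite mulf_eq0 gt_eqF//= => /eqP.
Qed.
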